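(* Let $\{M(t)\}_{t\ge0}$ be a GCP which performs $k$ kinds of jumps of amplitude $1,\dots,k$ with positive rates $\lambda_1,\dots,\lambda_k$, let $q\ge2$, and let $p_1,\dots,p_q>0$ with $\sum_{i=1}^{q}p_i=1$. Let $\{M_1(t)\}_{t\ge0},\dots,\{M_q(t)\}_{t\ge0}$ be the Type I split components of $\{M(t)\}_{t\ge0}$ obtained by rolling a $q$-faced die with face probabilities $p_1,\dots,p_q$. Then the processes $\{M_i(t)\}_{t\ge0}$, $i\in\{1,\dots,q\}$, are independent GCPs, and $\{M_i(t)\}_{t\ge0}$ performs $k$ kinds of jumps of amplitude $j\in\{1,2,\dots,k\}$ with positive rates $\lambda_jp_i$.
   Context: A counting process is an $\mathbb{N}_0$-valued process with nondecreasing right-continuous paths. A generalized counting process (GCP) performing $k$ kinds of jumps of amplitude $1,2,\dots,k$ with positive rates $\lambda_1,\dots,\lambda_k$ is a counting process $\{M(t)\}_{t\ge0}$ with $M(0)=0$ and independent and stationary increments such that, as $h\to0^+$, $\mathrm{Pr}\{M(t+h)=n+j\mid M(t)=n\}$ equals $1-\sum_{i=1}^k\lambda_i h+o(h)$ for $j=0$, $\lambda_jh+o(h)$ for $1\le j\le k$, and $o(h)$ for $j\ge k+1$. Type I splitting with a $q$-faced die: let $T_1<T_2<\cdots$ be the successive jump times of $\{M(t)\}_{t\ge0}$ and $J_1,J_2,\dots\in\{1,\dots,k\}$ the corresponding jump sizes. At each jump time $T_n$ the die is rolled once, giving outcome $\xi_n\in\{1,\dots,q\}$, where $\xi_1,\xi_2,\dots$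 are i.i.d. with $\mathrm{Pr}\{\xi_n=i\}=p_i$ and independent of $\{M(t)\}_{t\ge0}$. The whole jump $J_n$ is registered in component $\xi_n$: $M_i(t)=\sum_{n:\,T_n\le t}J_n\mathbf{1}\{\xi_n=i\}$, $1\le i\le q$. *)

(* Defs.v *)
From mathcomp Require Import all_boot all_order all_algebra finmap.
From mathcomp Require Import all_classical all_reals all_analysis.

Set Implicit Arguments.
Unset Strict Implicit.
Unset Printing Implicit Defensive.

Import Order.TTheory GRing.Theory Num.Theory.
Import numFieldNormedType.Exports.

Local Open Scope classical_set_scope.
Local Open Scope ring_scope.

(* The random variables considered take values in nat or in a finite type E,
   equipped with the discrete sigma-algebra of all subsets. *)
Section generated_sigma_algebras.
Context (T E : Type).

Definition sigma_of (X : T -> E) : set (set T) :=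
  preimage_set_system [set: T] X discrete_measurable.

Definition sigma_of_process (I : Type) (D : set I) (X : I -> T -> E) :
    set (set T) :=
  <<s \bigcup_(t in D) sigma_of (X t) >>.

End generated_sigma_algebras.

Section independence.
Context d (T : measurableType d) (R : realType) (P : probability T R).

Definition independent_family (I : choiceType) (F : I -> set (set T)) : Prop :=
  forall (J : {fset I}) (A : I -> set T),
    (forall i, i \in J -> F i (A i)) ->
    P (\bigcap_(i in [set` J]) A i) = (\prod_(i <- J) P (A i))%E.

Definition independent_pair (F G : set (set T)) : Prop :=
  forall A B, F A -> G B -> P (A `&` B) = (P A * P B)%E.

(* Equal to 0 when B is a null set. *)
Definition cond_prob (A B : set T) : R := fine (P (A `&` B)) / fine (P B).

End independence.

(* A process indexed by [0, +oo[ is a function R -> T -> nat; its values at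
   negative times are irrelevant. *)
Section counting_processes.
Context d (T : measurableType d) (R : realType) (P : probability T R).
Implicit Type M : R -> T -> nat.

Definition counting_process M : Prop :=
  [/\ (forall t : R, 0 <= t -> measurable_fun [set: T] (M t)),
      (forall w (s t : R), 0 <= s -> s <= t -> (M s w <= M t w)%N) &
      (forall w (t : R), 0 <= t -> M u w @[u --> t^'+] --> M t w)].

(* For nondecreasing M and s <= t the truncated subtraction is the usual one. *)
Definition increment M (s t : R) : T -> nat := fun w => (M t w - M s w)%N.

Definition independent_increments M : Prop :=
  forall (n : nat) (t : nat -> R), 0 <= t 0%N ->
    (forall i, (i < n)%N -> t i < t i.+1) ->
    independent_family P (fun i : 'I_n => sigma_of (increment M (t i) (t i.+1))).

Definition stationary_increments M : Prop :=
  forall s t h : R, 0 <= s -> s <= t -> 0 <= h ->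
    forall A : set nat,
      P (increment M (s + h) (t + h) @^-1` A) = P (increment M s t @^-1` A).

(* Pr {M (t + h) = n + j | M t = n} *)
Definition transition_prob M (t : R) (n j : nat) (h : R) : R :=
  cond_prob P (M (t + h) @^-1` [set (n + j)%N]) (M t @^-1` [set n]).

(* lam j is the rate of the jumps of amplitude j.+1, for j in {0, ..., k-1}.
   The transition probabilities are prescribed at the states n for which the
   conditional probability given M t = n is defined. *)
Definition gcp (k : nat) (lam : 'I_k -> R) M : Prop :=
  [/\ forall j, 0 < lam j,
      counting_process M,
      forall w, M 0 w = 0%N,
      independent_increments M /\ stationary_increments M &
      forall (t : R) (n : nat), 0 <= t -> (0 < P (M t @^-1` [set n]))%E ->
      [/\ (fun h : R =>
              transition_prob M t n 0 h - (1 - \sum_(j < k) lam j * h))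
            =o_ (0^'+) (fun h : R => h),
          forall j : 'I_k,
            (fun h : R => transition_prob M t n j.+1 h - lam j * h)
            =o_ (0^'+) (fun h : R => h) &
          forall j : nat, (k < j)%N ->
            (fun h : R => transition_prob M t n j h)
            =o_ (0^'+) (fun h : R => h)]].

End counting_processes.

Section splitting.
Context (R : realType).
Implicit Type x : R -> nat.

Definition jump_size x (s : R) : nat := (x s - lim (x u @[u --> s^'-]))%N.

Definition jump_points x : set R := [set s | 0 < s /\ (0 < jump_size x s)%N].

(* Jumps are numbered from 0: jump_time x n is the (n+1)-st jump time of the
   path x, and is +oo if x has at most n jumps. *)
Fixpoint jump_time x (n : nat) : \bar R :=
  match n with
  | 0%N => ereal_inf [set s%:E | s in jump_points x]
  | m.+1 => ereal_inf [set s%:E | s in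
              [set s | jump_points x s /\ (jump_time x m < s%:E)%E]]
  end.

(* The sum is finite for the paths of a counting process, which have at most
   x t jumps up to time t. *)
Definition split_path (q : nat) x (c : nat -> 'I_q) (i : 'I_q) (t : R) : nat :=
  \big[addn/0%N]_(n \in [set n | (jump_time x n <= t%:E)%E])
    (jump_size x (fine (jump_time x n)) * (c n == i))%N.

Definition typeI_split (T : Type) (q : nat) (M : R -> T -> nat)
    (xi : nat -> T -> 'I_q) (i : 'I_q) : R -> T -> nat :=
  fun t w => split_path (M ^~ w) (xi ^~ w) i t.

End splitting.

Section die.
Context d (T : measurableType d) (R : realType) (P : probability T R).

(* xi n is the outcome of the roll at the (n+1)-st jump time of M. *)
Definition die_rolls (q : nat) (p : 'I_q -> R) (M : R -> T -> nat)
    (xi : nat -> T -> 'I_q) : Prop :=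
  [/\ forall n i, measurable (xi n @^-1` [set i]),
      forall n i, P (xi n @^-1` [set i]) = (p i)%:E,
      independent_family P (fun n => sigma_of (xi n)) &
      independent_pair P (sigma_of_process [set: nat] xi)
                         (sigma_of_process [set t : R | 0 <= t] M)].

End die.

(* Main.v *)
(* Cut time into cells of length 1/N. The increments of M over the cells are
   i.i.d., and once N is so large that a path has at most one jump per cell, the
   n-th nonzero increment is the n-th jump, so that it goes to the face xi n.
   The independence of M and xi then yields, cell by cell, the joint generating
   function of these increments distributed over the faces: it is the product
   over the cells of sum_i p_i G_N(s_i), where G_N(s) = E s^M(1/N) is
   1 - (1/N) sum_j lam_j (1 - s^j) + o(1/N). Letting N go to infinity, the joint
   generating function of the increments of all the M_i over a time grid is the
   product, over the grid intervals and over i, of the exponentials of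
   - (length) sum_j lam_j p_i (1 - s^j). Independence of the components and of the
   increments, stationarity and transition rates are all read off this formula,
   by uniqueness and continuity of generating functions and a monotone class
   argument. *)
Require Import Defs.
From mathcomp Require Import all_boot all_order all_algebra finmap.
From mathcomp Require Import all_classical all_reals all_analysis.

From mathcomp Require Import measurable_realfun zify ring lra.

Import Order.TTheory GRing.Theory Num.Theory.
Import numFieldNormedType.Exports.

Local Open Scope classical_set_scope.
Local Open Scope ring_scope.

Set Implicit Arguments.
Unset Strict Implicit.
Unset Printing Implicit Defensive.

(** The die is tied to the number of a jump, and the number of the jump that falls in a given cell
    depends on the whole past of M. [cell_weight] meets this by carrying a counter of rolls through
    the cells. It makes sense for every mesh, even when a cell contains several jumps, so its
    expectation is computed exactly for each N; only its pointwise limit uses that a path eventually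
    has at most one jump per cell. The required N depends on the path, hence the passage to the
    limit by bounded convergence. The same limit yields the measurability of the components, without
    any measurability of the jump times. The factorisation over faces appears only in the limit:
    within a cell the faces mix additively, and raising the mixture to a power of order N turns this
    sum into a sum of exponents. To go from generating functions to events one variable at a time,
    expectations carry a bounded signed factor W, which absorbs all the other variables. *)

(** * Jumps of a single integer-valued right-continuous path *)

Section nat_paths.
Context (R : realType) (x : R -> nat).
Hypothesis x_mono : forall s t : R, 0 <= s -> s <= t -> (x s <= x t)%N.
Hypothesis x_rc : forall t : R, 0 <= t -> x u @[u --> t^'+] --> x t.
Hypothesis x0 : x 0 = 0%N.

(** Singletons of [nat] are open, so right-continuity at t is constancy on some [t, t + e). *)
Lemma right_constant (t : R) : 0 <= t ->
  exists2 e : R, 0 < e & forall u, t <= u -> u < t + e -> x u = x t.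
Proof.
move=> t0; have /(_ [set x t]) := x_rc t0.
move=> /(_ (discrete_set1 _)) /=.
rewrite /nbhs /= /at_right /within /= => -[e /= e0 He].
exists e => // u; rewrite le_eqVlt => /orP[/eqP<-//|tu] ue.
by apply: He => //=; rewrite ltr_distlC; apply/andP; split=> //; lra.
Qed.

Lemma jump_size_left (a s : R) (m : nat) : a < s ->
  (forall u, a <= u -> u < s -> x u = m) -> jump_size x s = (x s - m)%N.
Proof.
move=> as_ H; rewrite /jump_size; congr (_ - _)%N.
apply: cvg_lim; first exact: discrete_hausdorff.
apply: (@cvg_trans _ ((fun=> m) @ s^'-)); last exact: cvg_cst.
apply: near_eq_cvg; near=> u; rewrite H//.
by apply/ltW; near: u; exact: nbhs_left_gt.
Unshelve. all: by end_near. Qed.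

(** The infimum defining the next jump is attained whenever the path still moves after a. This lets
    the recursion of [jump_time] be followed one jump at a time. *)
Lemma first_jump_after (a : R) : 0 <= a ->
  let N := ereal_inf [set s%:E | s in [set s | jump_points x s /\ a < s]] in
  (N = +oo%E /\ forall u, a <= u -> x u = x a) \/
  (exists s, [/\ N = s%:E, a < s, forall u, a <= u -> u < s -> x u = x a,
     x s = (x a + jump_size x s)%N & (0 < jump_size x s)%N]).
Proof.
move=> a0 N.
have [H|H] := pselect (forall u, a <= u -> x u = x a).
  left; split=> //; rewrite /N (_ : [set s | _] = set0) ?image_set0 ?ereal_inf0//.
  apply/seteqP; split=> // s [[/= s0 js] as_].
  move: js; rewrite (@jump_size_left a s (x a))//; last by move=> u au _; apply: H.
  by rewrite H ?subnn// ltW.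
right.
have [u0 [au0 xu0]] : exists u, a <= u /\ (x a < x u)%N.
  apply/not_existsP => H1; apply: H => u au; apply/eqP; rewrite eqn_leq (x_mono a0 au) andbT.
  by rewrite leqNgt; apply/negP => H2; exact: (H1 u).
pose A := [set u | a <= u /\ (x a < x u)%N].
have hA : has_inf A by split; [exists u0 | exists a => u []].
pose s := inf A.
have as0 : a <= s by apply: lb_le_inf; [exists u0 | move=> u []].
have lts u : a <= u -> u < s -> x u = x a.
  move=> au us; apply/eqP; rewrite eqn_leq (x_mono a0 au) andbT leqNgt; apply/negP => H2.
  have : s <= u by apply: ge_inf; [exists a => v [] | split].
  by rewrite leNgt us.
(* Some point of [A] lies where the path still has the value x s, by constancy to the right of s;
   hence s itself belongs to [A]. *)
have xs : (x a < x s)%N.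
  have s0 : 0 <= s by apply: le_trans as0.
  have [e e0 He] := right_constant s0.
  have [u [au xu] us] := inf_adherent e0 hA.
  rewrite -(He u)//; apply: ge_inf; [exists a => v [] | split] => //.
have as_ : a < s.
  by rewrite lt_neqAle as0 andbT; apply/eqP => E; move: xs; rewrite -E ltnn.
have js := jump_size_left as_ lts.
exists s; split=> //; last first.
- by rewrite js subn_gt0.
- by rewrite js subnKC// ltnW.
apply/eqP; rewrite eq_le; apply/andP; split.
  apply: ereal_inf_lbound; exists s => //; split=> //; split; first exact: le_lt_trans as_.
  by rewrite js subn_gt0.
apply: le_ereal_inf_tmp => _ [v [[/= v0 jv] av] <-]; rewrite lee_fin leNgt; apply/negP => vs.
move: jv; rewrite (@jump_size_left a v (x a))//; last by move=> u au uv; apply: lts => //; lra.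
by rewrite lts ?subnn// ltW.
Qed.

Let tau := jump_time x.
Let sz n := jump_size x (fine (tau n)).

Lemma jump_timeS n : tau n.+1 =
  ereal_inf [set s%:E | s in [set s | jump_points x s /\ (tau n < s%:E)%E]].
Proof. by []. Qed.

Lemma jump_time_pinfty n : tau n = +oo%E -> tau n.+1 = +oo%E.
Proof.
move=> E; rewrite jump_timeS E (_ : [set s | _] = set0) ?image_set0 ?ereal_inf0//.
by apply/seteqP; split=> // s [_]; rewrite ltNge leey.
Qed.

Lemma jump_time_step n (s : R) : tau n = s%:E -> 0 <= s ->
  (tau n.+1 = +oo%E /\ forall u, s <= u -> x u = x s) \/
  (exists s', [/\ tau n.+1 = s'%:E, s < s', forall u, s <= u -> u < s' -> x u = x s,
     x s' = (x s + sz n.+1)%N & (0 < sz n.+1)%N]).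
Proof.
move=> E s0; have := first_jump_after s0.
rewrite (_ : ereal_inf _ = tau n.+1); last first.
  by rewrite jump_timeS E; congr (ereal_inf (_ @` _)).
move=> [H|[s' [H1 H2 H3 H4 H5]]]; [by left|right].
by exists s'; split=> //; rewrite /sz H1.
Qed.

Lemma jump_time_step0 :
  (tau 0 = +oo%E /\ forall u, 0 <= u -> x u = 0%N) \/
  (exists s', [/\ tau 0 = s'%:E, 0 < s', forall u, 0 <= u -> u < s' -> x u = 0%N,
     x s' = sz 0 & (0 < sz 0)%N]).
Proof.
have := first_jump_after (lexx 0); rewrite x0.
rewrite (_ : ereal_inf _ = tau 0); last first.
  rewrite /tau /=; congr (ereal_inf (_ @` _)).
  by apply/seteqP; split=> v /= => [[]//|jv]; split=> //; case: jv.
move=> [H|[s' [H1 H2 H3 H4 H5]]]; [by left|right].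
by exists s'; split=> //; rewrite /sz H1.
Qed.

Lemma jump_time_cases n :
  tau n = +oo%E \/
  (exists s, [/\ tau n = s%:E, 0 < s, (0 < sz n)%N & x s = (\sum_(m < n.+1) sz m)%N]).
Proof.
elim: n => [|n [IH|[s [E s0 szn xs]]]].
- have [[]|[s [H1 H2 _ H3 H4]]] := jump_time_step0; [by left|right].
  by exists s; split=> //; rewrite big_ord_recl big_ord0 addn0.
- by left; exact: jump_time_pinfty.
- have [[]|[s' [H1 H2 H3 H4 H5]]] := jump_time_step E (ltW s0); [by left|right].
  by exists s'; split=> //; [exact: lt_trans H2 | rewrite big_ord_recr /= -xs].
Qed.

Lemma jump_time_gt0 n : (0 < tau n)%E.
Proof. by have [->|[s [-> s0 _ _]]] := jump_time_cases n. Qed.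

Lemma jump_time_leS n : (tau n <= tau n.+1)%E.
Proof.
have [E|[s [E s0 _ _]]] := jump_time_cases n; first by rewrite jump_time_pinfty ?E.
have [[-> _]|[s' [-> H _ _ _]]] := jump_time_step E (ltW s0); rewrite ?leey//.
by rewrite E lee_fin ltW.
Qed.

Lemma jump_time_le m n : (m <= n)%N -> (tau m <= tau n)%E.
Proof.
elim: n => [|n IH]; first by rewrite leqn0 => /eqP->.
rewrite leq_eqVlt => /orP[/eqP->//|/IH h].
exact: le_trans h (jump_time_leS n).
Qed.

Lemma jump_time_lt m n (s : R) : (m < n)%N -> tau m = s%:E -> (tau m < tau n)%E.
Proof.
move=> mn E; apply: lt_le_trans (jump_time_le mn).
have [E'|[s' [Es' s0 _ _]]] := jump_time_cases m; first by rewrite E' in E.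
have [[-> _]|[s'' [-> H _ _ _]]] := jump_time_step Es' (ltW s0); first by rewrite E ltry.
by rewrite Es' lte_fin.
Qed.

(** Each of the n + 1 jumps up to t contributes at least 1 to x t, so jumps cannot accumulate. *)
Lemma jump_time_bound n (t : R) : (tau n <= t%:E)%E -> (n < x t)%N.
Proof.
have [->|[s [E s0 _ xs]]] := jump_time_cases n; first by rewrite leNgt ltry.
rewrite E lee_fin => st; apply: leq_trans (x_mono (ltW s0) st).
rewrite xs -[X in (X <= _)%N]card_ord -sum1_card; apply: leq_sum => i _.
have /(jump_time_le) : (i <= n)%N by rewrite -ltnS.
by have [->|[? []//]] := jump_time_cases i; rewrite E leNgt ltry.
Qed.

(** By [jump_time_bound] it is enough to search the first x t indices. If all these jumps occur by
    time t, [find] returns the length x t, which is then the correct count. *)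
Definition jump_count (t : R) : nat :=
  find (fun n => (t%:E < jump_time x n)%E) (iota 0 (x t)).

Lemma jump_countP (t : R) n : (tau n <= t%:E)%E = (n < jump_count t)%N.
Proof.
pose p n := (t%:E < jump_time x n)%E.
have fs : (jump_count t <= x t)%N by have := find_size p (iota 0 (x t)); rewrite size_iota.
apply/idP/idP => H.
  rewrite ltnNge; apply/negP => jn.
  have nx := jump_time_bound H.
  have jx : (jump_count t < x t)%N by apply: leq_ltn_trans nx.
  have hp : has p (iota 0 (x t)) by rewrite has_find size_iota.
  have := nth_find 0%N hp; rewrite nth_iota// /p add0n ltNge => /negP; apply.
  exact: le_trans (jump_time_le jn) H.
have := before_find 0%N H; rewrite nth_iota ?add0n; last by exact: leq_trans fs.
by move/negbT; rewrite -leNgt.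
Qed.

Lemma path_sum_jumps (t : R) : 0 <= t -> x t = (\sum_(n < jump_count t) sz n)%N.
Proof.
move=> t0; case E : (jump_count t) => [|m].
  rewrite big_ord0; have := jump_countP t 0; rewrite E ltnn => /negbT; rewrite -ltNge.
  by have [[_ H _]|[s [-> s0 H _ _]]] := jump_time_step0; [exact: H|rewrite lte_fin; exact: H].
have : (tau m <= t%:E)%E by rewrite jump_countP E.
have : (t%:E < tau m.+1)%E by rewrite ltNge jump_countP E ltnn.
have [->|[s [Es s0 _ <-]]] := jump_time_cases m; first by rewrite !leNgt ltry.
rewrite Es lee_fin => ts st.
have [[_ H]|[s' [Es' ss' H _ _]]] := jump_time_step Es (ltW s0); first exact: H.
by apply: H => //; move: ts; rewrite Es' lte_fin.
Qed.

Lemma jump_size_gt0 (t : R) n : (n < jump_count t)%N -> (0 < sz n)%N.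
Proof.
rewrite -jump_countP; have [->|[? []//]] := jump_time_cases n.
by rewrite leNgt ltry.
Qed.

Lemma jump_count_mono (s t : R) : s <= t -> (jump_count s <= jump_count t)%N.
Proof.
move=> st; rewrite leqNgt; apply/negP => H.
have := jump_countP s (jump_count t); rewrite H => /(le_trans)/(_ (_ : s%:E <= t%:E)%E).
by rewrite lee_fin => /(_ st); rewrite jump_countP ltnn.
Qed.

Lemma jump_count0 : jump_count 0 = 0%N.
Proof. by apply/eqP; rewrite -leqn0 leqNgt -jump_countP -ltNge jump_time_gt0. Qed.

Lemma jump_count_eq (a b : R) : 0 <= a -> a <= b ->
  x a = x b -> jump_count a = jump_count b.
Proof.
move=> a0 ab; have b0 := le_trans a0 ab.
rewrite (path_sum_jumps a0) (path_sum_jumps b0) => E.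
apply/eqP; rewrite eqn_leq jump_count_mono//= leqNgt; apply/negP => H.
move: E; rewrite -(big_mkord xpredT (fun n => sz n)) -[RHS](big_mkord xpredT (fun n => sz n)).
rewrite (@big_cat_nat _ _ _ (jump_count a) 0 (jump_count b))//=; last exact: ltnW.
rewrite -[LHS]addn0 => /eqP; rewrite eqn_add2l big_ltn// eq_sym addn_eq0.
by have := jump_size_gt0 H; rewrite lt0n => /negPf->.
Qed.

Variables (q : nat) (c : nat -> 'I_q).

Lemma split_path_sum (i : 'I_q) (t : R) :
  split_path x c i t = (\sum_(n < jump_count t) sz n * (c n == i))%N.
Proof.
rewrite /split_path (_ : [set n | _] = `I_(jump_count t)) -?fsbig_ord//.
by apply/seteqP; split=> n /=; rewrite jump_countP.
Qed.

Lemma split_path_eq (i : 'I_q) (a b : R) : 0 <= a -> a <= b ->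
  x a = x b -> split_path x c i a = split_path x c i b.
Proof. by move=> *; rewrite !split_path_sum (@jump_count_eq a b). Qed.

Lemma split_path0 (i : 'I_q) : split_path x c i 0 = 0%N.
Proof. by rewrite split_path_sum jump_count0 big_ord0. Qed.

Lemma split_path_mono (i : 'I_q) (a b : R) : a <= b ->
  (split_path x c i a <= split_path x c i b)%N.
Proof.
move=> ab; rewrite !split_path_sum.
rewrite -!(big_mkord xpredT (fun n => sz n * (c n == i))%N).
rewrite [leqRHS](@big_cat_nat _ _ _ (jump_count a))//=; first exact: leq_addr.
exact: jump_count_mono.
Qed.

Lemma split_path_right_constant (i : 'I_q) (t : R) : 0 <= t ->
  exists2 e : R, 0 < e & forall u, t <= u -> u < t + e ->
    split_path x c i u = split_path x c i t.
Proof.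
move=> t0; have [e e0 H] := right_constant t0; exists e => // u tu ue.
by apply/esym/split_path_eq => //; rewrite H.
Qed.

Lemma split_path_single_jump (i : 'I_q) (a b : R) : 0 <= a -> a <= b ->
  jump_count b = (jump_count a).+1 ->
  split_path x c i b =
    (split_path x c i a + (x b - x a) * (c (jump_count a) == i))%N.
Proof.
move=> a0 ab E; have b0 := le_trans a0 ab.
rewrite !split_path_sum (path_sum_jumps a0) (path_sum_jumps b0) E !big_ord_recr /=.
by rewrite addKn.
Qed.

(** Only finitely many jumps occur up to b, so e can be the least gap between consecutive ones; two
    jumps in one cell would be closer than that. *)
Lemma jump_count_mesh (b : R) : exists2 e : R, 0 < e &
  forall s t : R, 0 <= s -> s <= t -> t <= b -> t - s < e ->
    (jump_count t <= (jump_count s).+1)%N.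
Proof.
have : forall m, (m <= jump_count b)%N -> exists2 e : R, 0 < e & forall n s s',
    (n.+1 < m)%N -> tau n = s%:E -> tau n.+1 = s'%:E -> e <= s' - s.
  elim=> [|[|m] IH] mb; [by exists 1|by exists 1|].
  have [e e0 He] := IH (ltnW mb).
  have : (tau m <= b%:E)%E by rewrite jump_countP ltnW.
  have : (tau m.+1 <= b%:E)%E by rewrite jump_countP.
  have [->|[s' [Es' _ _ _]]] := jump_time_cases m.+1; first by rewrite leNgt ltry.
  move=> _; have [->|[s [Es _ _ _]]] := jump_time_cases m; first by rewrite leNgt ltry.
  move=> _; have ss' : s < s'.
    by have := @jump_time_lt m m.+1 s (ltnSn _) Es; rewrite Es Es' lte_fin.
  exists (Num.min e (s' - s)); first by rewrite lt_min e0 subr_gt0.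
  move=> n u u'; rewrite ltnS leq_eqVlt => /orP[/eqP[->]|nm] Eu Eu'.
    by move: Eu Eu'; rewrite Es Es' => -[->] [->]; rewrite ge_min lexx orbT.
  by rewrite ge_min (He n)// .
move=> /(_ _ (leqnn _)) [e e0 He]; exists e => // s t s0 st tb tse.
rewrite leqNgt; apply/negP => H.
have H2 : (tau (jump_count s).+1 <= t%:E)%E by rewrite jump_countP.
have H1 : (tau (jump_count s) <= t%:E)%E by rewrite jump_countP ltnW.
have H3 : (s%:E < tau (jump_count s))%E by rewrite ltNge jump_countP ltnn.
have Hb : ((jump_count s).+1 < jump_count b)%N.
  exact: leq_trans (jump_count_mono tb).
move: H1 H2 H3.
have [->|[u [Eu _ _ _]]] := jump_time_cases (jump_count s); first by rewrite leNgt ltry.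
have [->|[u' [Eu' _ _ _]]] := jump_time_cases (jump_count s).+1.
  by move=> _; rewrite leNgt ltry.
have := He _ _ _ Hb Eu Eu'.
by rewrite Eu Eu' !lee_fin lte_fin; lra.
Qed.

End nat_paths.

(** * Expectation of bounded random variables *)

Section expectation.
Context d (T : measurableType d) (R : realType) (P : probability T R).
Implicit Types f g : T -> R.

(** Closed under all the operations used below, so that integrability follows from the shape of the
    integrand. *)
Definition bounded_rv f :=
  measurable_fun setT f /\ exists C : R, forall w, `|f w| <= C.

Definition Ex f : R := \int[P]_w f w.

Lemma bounded_rv_integrable f : bounded_rv f -> P.-integrable setT (EFin \o f).
Proof.
move=> [mf [C HC]]; apply: measurable_bounded_integrable => //.
  by apply: le_lt_trans (probability_le1 P measurableT) _; rewrite ltry.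
exists C; split; first exact: num_real.
by move=> x Cx w _ /=; apply: le_trans (HC w) (ltW Cx).
Qed.

Lemma bounded_rv_cst (c : R) : bounded_rv (fun=> c).
Proof. by split; [exact: measurable_cst | exists `|c|]. Qed.

Lemma bounded_rvD f g : bounded_rv f -> bounded_rv g -> bounded_rv (fun w => f w + g w).
Proof.
move=> [mf [C HC]] [mg [D HD]]; split; first exact: measurable_funD.
by exists (C + D) => w; apply: le_trans (ler_normD _ _) _; exact: lerD.
Qed.

Lemma bounded_rvM f g : bounded_rv f -> bounded_rv g -> bounded_rv (fun w => f w * g w).
Proof.
move=> [mf [C HC]] [mg [D HD]]; split; first exact: measurable_funM.
by exists (C * D) => w; rewrite normrM; apply: ler_pM.
Qed.

Lemma bounded_rvB f g : bounded_rv f -> bounded_rv g -> bounded_rv (fun w => f w - g w).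
Proof.
move=> bf bg; rewrite (_ : (fun w => _) = (fun w => f w + (fun=> -1) w * g w)).
  by apply: bounded_rvD => //; apply: bounded_rvM => //; exact: bounded_rv_cst.
by apply/funext => w; rewrite mulN1r.
Qed.

Lemma bounded_rv_sum (I : Type) (r : seq I) (F : I -> T -> R) :
  (forall i, bounded_rv (F i)) -> bounded_rv (fun w => \sum_(i <- r) F i w).
Proof.
move=> H; elim: r => [|i r IH].
  by under eq_fun do rewrite big_nil; exact: bounded_rv_cst.
by under eq_fun do rewrite big_cons; exact: bounded_rvD.
Qed.

Lemma bounded_rv_prod (I : Type) (r : seq I) (F : I -> T -> R) :
  (forall i, bounded_rv (F i)) -> bounded_rv (fun w => \prod_(i <- r) F i w).
Proof.
move=> H; elim: r => [|i r IH].
  by under eq_fun do rewrite big_nil; exact: bounded_rv_cst.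
by under eq_fun do rewrite big_cons; exact: bounded_rvM.
Qed.

Lemma bounded_rv_indic (A : set T) : measurable A -> bounded_rv (\1_A).
Proof.
move=> mA; split; first exact: measurable_indic.
by exists 1 => w; rewrite indicE normr_nat lern1 leq_b1.
Qed.

Lemma bounded_rv_nat (Y : T -> nat) (h : nat -> R) (C : R) :
  measurable_fun setT Y -> (forall n, `|h n| <= C) -> bounded_rv (fun w => h (Y w)).
Proof.
move=> mY HC; split; last by exists C => w.
by apply: (@measurableT_comp _ _ _ _ _ _ h) => // _ B mB.
Qed.

Lemma Ex_cst (c : R) : Ex (fun=> c) = c.
Proof.
rewrite /Ex Rintegral_cst// (_ : fine _ = 1) ?mulr1//.
by rewrite [X in fine X](probability_setT P).
Qed.

Lemma ExD f g : bounded_rv f -> bounded_rv g -> Ex (fun w => f w + g w) = Ex f + Ex g.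
Proof. by move=> bf bg; rewrite /Ex RintegralD//; exact: bounded_rv_integrable. Qed.

Lemma ExB f g : bounded_rv f -> bounded_rv g -> Ex (fun w => f w - g w) = Ex f - Ex g.
Proof. by move=> bf bg; rewrite /Ex RintegralB//; exact: bounded_rv_integrable. Qed.

Lemma ExZ (c : R) f : bounded_rv f -> Ex (fun w => c * f w) = c * Ex f.
Proof. by move=> bf; rewrite /Ex RintegralZl//; exact: bounded_rv_integrable. Qed.

Lemma Ex_sum (I : Type) (r : seq I) (F : I -> T -> R) : (forall i, bounded_rv (F i)) ->
  Ex (fun w => \sum_(i <- r) F i w) = \sum_(i <- r) Ex (F i).
Proof.
move=> H; elim: r => [|i r IH].
  by under eq_fun do rewrite big_nil; rewrite big_nil Ex_cst.
under eq_fun do rewrite big_cons.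
by rewrite ExD ?IH ?big_cons//; exact: bounded_rv_sum.
Qed.

Lemma le_Ex f g : bounded_rv f -> bounded_rv g -> (forall w, f w <= g w) -> Ex f <= Ex g.
Proof.
by move=> bf bg fg; apply: le_Rintegral => //; exact: bounded_rv_integrable.
Qed.

Lemma eq_Ex f g : f =1 g -> Ex f = Ex g.
Proof. by move=> /funext->. Qed.

Lemma norm_Ex_le_Ex f g : bounded_rv f -> bounded_rv g ->
  (forall w, `|f w| <= g w) -> `|Ex f| <= Ex g.
Proof.
move=> bf bg fg; rewrite ler_norml; apply/andP; split.
  rewrite -mulN1r -ExZ//; apply: le_Ex => //.
    by apply: bounded_rvM => //; exact: bounded_rv_cst.
  by move=> w; have := fg w; rewrite mulN1r ler_norml => /andP[].
by apply: le_Ex => // w; have := fg w; rewrite ler_norml => /andP[].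
Qed.

Lemma bounded_rv_norm f : bounded_rv f -> bounded_rv (fun w => `|f w|).
Proof.
move=> [mf [C HC]]; split; first exact: measurableT_comp.
by exists C => w; rewrite normr_id.
Qed.

Lemma Ex_indic (A : set T) : measurable A -> Ex (\1_A) = fine (P A).
Proof. by move=> mA; rewrite /Ex /Rintegral integral_indic// setIT. Qed.

Lemma Ex_indicE (A : set T) : measurable A -> P A = (Ex (\1_A))%:E.
Proof. by move=> mA; rewrite Ex_indic// fineK//; exact: fin_num_measure. Qed.

Lemma bounded_cvg_Ex (F : nat -> T -> R) f (C : R) :
  (forall n, bounded_rv (F n)) -> (forall n w, `|F n w| <= C) ->
  (forall w, F n w @[n --> \oo] --> f w) ->
  bounded_rv f /\ Ex (F n) @[n --> \oo] --> Ex f.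
Proof.
move=> bF HC cF.
have mf : measurable_fun setT f.
  by apply: (@measurable_fun_cvg _ _ _ _ F) => // n; have [] := bF n.
have bf : bounded_rv f.
  split=> //; exists C => w; have /cvg_norm h := cF w.
  rewrite -(cvg_lim (@norm_hausdorff _ _) h); apply: limr_le; first by apply/cvg_ex; exists `|f w|.
  by apply: nearW => n; exact: HC.
split=> //.
have [] := @dominated_convergence _ T R P setT measurableT
  (fun n w => (F n w)%:E) (fun w => (f w)%:E) (fun=> C%:E).
- by move=> n; apply/measurable_EFinP; have [] := bF n.
- exact/measurable_EFinP.
- by apply: aeW => w _; apply: cvg_EFin; [exact: nearW|exact: cF].
- exact: (bounded_rv_integrable (bounded_rv_cst C)).
- by apply: aeW => w n _; rewrite lee_fin.
move=> _ _ /= H; apply: fine_cvg.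
rewrite fineK//; apply: integrable_fin_num => //; exact: bounded_rv_integrable.
Qed.

End expectation.

(** * Coefficients of power series and their limits *)

Section coefficients.
Context (R : realType).

Lemma cvg_sum_seq (I J : Type) (F : set_system I) {FF : Filter F} (r : seq J)
    (f : J -> I -> R) (l : J -> R) :
  (forall j, f j i @[i --> F] --> l j) ->
  (\sum_(j <- r) f j i) @[i --> F] --> \sum_(j <- r) l j.
Proof.
move=> H; elim: r => [|j r IH].
  by under eq_cvg do rewrite big_nil; rewrite big_nil; exact: cvg_cst.
by under eq_cvg do rewrite big_cons; rewrite big_cons; exact: cvgD.
Qed.

Lemma cvg_prod_seq (I J : Type) (F : set_system I) {FF : Filter F} (r : seq J)
    (f : J -> I -> R) (l : J -> R) :
  (forall j, f j i @[i --> F] --> l j) ->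
  (\prod_(j <- r) f j i) @[i --> F] --> \prod_(j <- r) l j.
Proof.
move=> H; elim: r => [|j r IH].
  by under eq_cvg do rewrite big_nil; rewrite big_nil; exact: cvg_cst.
by under eq_cvg do rewrite big_cons; rewrite big_cons; exact: cvgM.
Qed.

(** A power series described by its remainders, with one constant for all orders and signed
    coefficients. Sharing C along a family is what makes limits of coefficients possible. *)
Definition expands (b : nat -> R) (g : R -> R) (C : R) :=
  forall (s : R) m, 0 <= s <= 1 -> `|g s - \sum_(n < m) b n * s ^+ n| <= C * s ^+ m.

Lemma expandsB b g C b' g' C' : expands b g C -> expands b' g' C' ->
  expands (fun n => b n - b' n) (fun s => g s - g' s) (C + C').
Proof.
move=> H H' s m s01; rewrite mulrDl.
under eq_bigr do rewrite mulrBl.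
rewrite sumrB opprB addrACA -opprB opprD opprK addrA.
apply: le_trans (lerD (H s m s01) (H' s m s01)).
rewrite -[X in _ <= _ + X]normrN; apply: le_trans (ler_normD _ _).
by rewrite le_eqVlt; apply/orP; left; apply/eqP; congr `| _ |; ring.
Qed.

(** Continuity theorem, by strong induction on n: the coefficients below n already tend to 0, so
    subtracting them from g leaves b n s^n up to an error C s^(n+1). *)
Lemma coef_cvg0 (I : Type) (F : set_system I) {FF : Filter F}
    (b : I -> nat -> R) (g : I -> R -> R) (C : R) :
  (\forall i \near F, expands (b i) (g i) C) ->
  (forall s, 0 < s <= 1 -> g i s @[i --> F] --> (0 : R)) ->
  forall n, b i n @[i --> F] --> (0 : R).
Proof.
move=> Hb Hg n; elim/ltn_ind: n => n IH.
apply/cvgr0Pnorm_le => /= e e0.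
(* After division by s^n the remainder of order n+1 is at most C s. *)
pose s : R := Num.min 1 (e / 2 / (`|C| + 1)).
have C1 : 0 < `|C| + 1 by rewrite ltr_wpDl.
have s0 : 0 < s by rewrite lt_min ltr01 !divr_gt0.
have s1 : s <= 1 by rewrite ge_min lexx.
have Cs : C * s <= e / 2.
  apply: le_trans (_ : (`|C| + 1) * s <= _).
    by rewrite ler_pM2r// (le_trans (ler_norm C))// lerDl.
  by rewrite mulrC -ler_pdivlMr// ge_min lexx orbT.
have sn0 : 0 < s ^+ n by rewrite exprn_gt0.
pose u i := g i s - \sum_(k < n) b i k * s ^+ k.
have u0 : u i @[i --> F] --> (0 : R).
  rewrite -[X in _ --> X](subr0 0); apply: cvgB; first by apply: Hg; rewrite s0.
  rewrite [X in _ --> X](_ : 0 = \sum_(k < n) (0 : R)); last by rewrite big1.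
  apply: cvg_sum_seq => k; rewrite -[X in _ --> X](mul0r (s ^+ k)).
  by apply: cvgM; [exact: IH | exact: cvg_cst].
have es : 0 < e / 2 * s ^+ n by rewrite mulr_gt0// divr_gt0.
move/cvgr0Pnorm_le : u0 => /(_ _ es) u0.
near=> i.
have Hi : expands (b i) (g i) C by near: i.
have ui : `|u i| <= e / 2 * s ^+ n by near: i.
have := Hi s n.+1; rewrite (ltW s0) s1 => /(_ isT).
rewrite big_ord_recr /= opprD addrA -/(u i) exprS mulrA => H.
have : `|b i n * s ^+ n| <= e * s ^+ n.
  rewrite -[X in `|X|](subKr (u i)).
  apply: le_trans (ler_normB _ _) _.
  have : C * s * s ^+ n <= e / 2 * s ^+ n by rewrite ler_pM2r.
  lra.
by rewrite normrM (ger0_norm (ltW sn0)) ler_pM2r.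
Unshelve. all: by end_near. Qed.

Lemma coef_unique (b : nat -> R) (g : R -> R) (C : R) :
  expands b g C -> (forall s, 0 < s <= 1 -> g s = 0) -> forall n, b n = 0.
Proof.
move=> H Hg n.
have : b n @[i --> \oo] --> (0 : R).
  apply: (@coef_cvg0 nat \oo _ (fun=> b) (fun=> g) C); first exact: nearW.
  by move=> s s01; rewrite Hg//; exact: cvg_cst.
by move/cvg_lim => <-//; rewrite lim_cst.
Qed.

End coefficients.

(** * Generating functions with a bounded weight *)

Section generating_function.
Context d (T : measurableType d) (R : realType) (P : probability T R).
Variables (Y : T -> nat) (mY : measurable_fun setT Y).

Lemma measurable_nat_preimage (A : set nat) : measurable (Y @^-1` A).
Proof. by rewrite -[X in measurable X]setTI; exact: mY. Qed.

Lemma bounded_rv_pow (s : R) : 0 <= s <= 1 -> bounded_rv (fun w => s ^+ Y w).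
Proof.
move=> /andP[s0 s1]; apply: (bounded_rv_nat (h := fun n => s ^+ n) (C := 1)) => // n.
by rewrite ger0_norm ?exprn_ge0// exprn_ile1.
Qed.

(** Where Y < m the partial sum equals W s^Y exactly; elsewhere it vanishes and s^Y <= s^m. *)
Lemma gf_expands (W : T -> R) : bounded_rv W ->
  expands (fun n => Ex P (fun w => W w * \1_(Y @^-1` [set n]) w))
          (fun s => Ex P (fun w => W w * s ^+ Y w)) (Ex P (fun w => `|W w|)).
Proof.
move=> bW s m s01; have /andP[s0 s1] := s01.
have bI n : bounded_rv (\1_(Y @^-1` [set n]) : T -> R).
  by apply: bounded_rv_indic; exact: measurable_nat_preimage.
have bWI n : bounded_rv (fun w => W w * (\1_(Y @^-1` [set n]) w : R)) by exact: bounded_rvM.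
under eq_bigr => n _ do rewrite mulrC -ExZ//.
have bs := bounded_rv_pow s01.
rewrite -(@Ex_sum _ _ _ P _ _ (fun (n : 'I_m) w =>
    s ^+ n * (W w * \1_(Y @^-1` [set val n]) w))); last first.
  by move=> n; apply: bounded_rvM => //; exact: bounded_rv_cst.
rewrite -ExB; [|exact: bounded_rvM|]; last first.
  by apply: bounded_rv_sum => n; apply: bounded_rvM => //; exact: bounded_rv_cst.
rewrite mulrC -ExZ; last exact: bounded_rv_norm.
apply: norm_Ex_le_Ex.
- apply: bounded_rvB; first exact: bounded_rvM.
  by apply: bounded_rv_sum => n; apply: bounded_rvM => //; exact: bounded_rv_cst.
- by apply: bounded_rvM; [exact: bounded_rv_cst|exact: bounded_rv_norm].
move=> w; rewrite [leRHS]mulrC.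
case: (ltnP (Y w) m) => Ym.
  rewrite (bigD1 (Ordinal Ym))//= big1 ?addr0; last first.
    move=> n /eqP nY; rewrite indicE memNset ?mulr0//= => E; apply: nY.
    by apply: val_inj.
  by rewrite indicE mem_set//= mulr1 mulrC subrr normr0 mulr_ge0// exprn_ge0.
rewrite big1 ?subr0; last first.
  by move=> n _; rewrite indicE memNset ?mulr0//= => E; move: Ym; rewrite E leqNgt ltn_ord.
rewrite normrM ler_wpM2l//.
by rewrite ger0_norm ?exprn_ge0//; apply: ler_wiXn2l.
Qed.

Lemma gf_determines (W : T -> R) : bounded_rv W ->
  (forall s : R, 0 <= s <= 1 -> Ex P (fun w => W w * s ^+ Y w) = 0) ->
  forall n, Ex P (fun w => W w * \1_(Y @^-1` [set n]) w) = 0.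
Proof.
move=> bW H n; apply: (coef_unique (gf_expands bW)) => s /andP[s0 s1].
by apply: H; rewrite (ltW s0).
Qed.

End generating_function.

(** * Test functions determining a sigma-algebra *)

Section determining_classes.
Context d (T : measurableType d) (R : realType) (P : probability T R).

(** W is allowed to be signed so that it can be a product of other variables minus a constant. *)
Definition determines (K : set (T -> R)) (G : set (set T)) := forall A, G A ->
  measurable A /\ forall W : T -> R, bounded_rv W ->
    (forall f, K f -> Ex P (fun w => W w * f w) = 0) ->
    Ex P (fun w => W w * \1_A w) = 0.

Lemma prod_indic (I : choiceType) (r : seq I) (A : I -> set T) (w : T) :
  \prod_(i <- r) (\1_(A i) w : R) = \1_(\bigcap_(i in [set` r]) A i) w.
Proof.
elim: r => [|i r IH].
  by rewrite big_nil indicE mem_set.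
rewrite big_cons IH !indicE -natrM mulnb; congr (_%:R); congr nat_of_bool.
apply/andP/idP => [[/set_mem h1 /set_mem h2]|/set_mem h].
  by apply/mem_set => j /=; rewrite inE => /orP[/eqP->//|]; exact: h2.
split; apply/mem_set; first by apply: h; rewrite /= inE eqxx.
by move=> j /= jr; apply: h; rewrite /= inE jr orbT.
Qed.

(** Let V be the product of the other factors and c the product of their expectations. Factorisation
    with a further factor g reads E ((V - c) g) = 0, a condition that passes from all g in K i to
    the indicator of A i. *)
Lemma determines_independent (I : choiceType) (K : I -> set (T -> R))
    (G : I -> set (set T)) :
  (forall i f, K i f -> bounded_rv f) ->
  (forall i, determines (K i) (G i)) ->
  (forall i, K i (fun=> 1)) ->
  (forall (r : seq I) (f : I -> T -> R), uniq r -> (forall i, K i (f i)) ->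
    Ex P (fun w => \prod_(i <- r) f i w) = \prod_(i <- r) Ex P (f i)) ->
  independent_family P G.
Proof.
move=> bK dK K1 HK J A GA.
have mA i : i \in J -> measurable (A i) by move=> /GA /(dK i) [].
(* A i is known to be measurable only for i in J; the default [setT] makes every B i measurable. *)
pose B i := if i \in J then A i else setT.
have mB i : measurable (B i) by rewrite /B; case: ifP => // /mA.
have bB i : bounded_rv (\1_(B i) : T -> R) by exact: bounded_rv_indic.
(* The [f i] are replaced by the indicators of the [A i] one index at a time. *)
have main (r1 r2 : seq I) (f : I -> T -> R) : uniq (r1 ++ r2) -> {subset r1 <= J} ->
    (forall i, K i (f i)) ->
    Ex P (fun w => \prod_(i <- r1) \1_(B i) w * \prod_(i <- r2) f i w) =
    \prod_(i <- r1) Ex P (\1_(B i)) * \prod_(i <- r2) Ex P (f i).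
  elim: r1 r2 f => [|i r1 IH] r2 f.
    move=> u _ Kf; rewrite big_nil mul1r -HK//; apply: eq_Ex => w.
    by rewrite big_nil mul1r.
  move=> u sJ Kf.
  have /andP[ni u12] : (i \notin r1 ++ r2) && uniq (r1 ++ r2) by move: u.
  have sJ1 : {subset r1 <= J} by move=> j jr; apply: sJ; rewrite inE jr orbT.
  have iJ : i \in J by apply: sJ; rewrite inE eqxx.
  have [_ /(_ (fun w => \prod_(i <- r1) \1_(B i) w * \prod_(i <- r2) f i w -
    \prod_(i <- r1) Ex P (\1_(B i)) * \prod_(i <- r2) Ex P (f i)))] := dK i _ (GA i iJ).
  set c := \prod_(i <- r1) Ex P (\1_(B i)) * \prod_(i <- r2) Ex P (f i).
  set V := fun w => \prod_(i <- r1) \1_(B i) w * \prod_(i <- r2) f i w.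
  have bV : bounded_rv V.
    by apply: bounded_rvM; apply: bounded_rv_prod => j //; apply: bK; exact: Kf.
  have bW : bounded_rv (fun w => V w - c) by apply: bounded_rvB => //; exact: bounded_rv_cst.
  have split g : bounded_rv g ->
      Ex P (fun w => (V w - c) * g w) = Ex P (fun w => V w * g w) - c * Ex P g.
    move=> bg; rewrite -ExZ// -ExB; first by apply: eq_Ex => w; rewrite mulrBl.
      exact: bounded_rvM.
    by apply: bounded_rvM => //; exact: bounded_rv_cst.
  move=> /(_ bW) H.
  have {}H : Ex P (fun w => (V w - c) * \1_(A i) w) = 0.
    apply: H => g Kg; rewrite split; last exact: bK Kg.
    (* As i does not occur in r2, inserting g at i leaves the other factors unchanged and the
       induction hypothesis applies to i :: r2. *)
    pose f' j := if j == i then g else f j.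
    have := IH (i :: r2) f'.
    have nr2 : {in r2, forall j, f' j = f j}.
      move=> j jr; rewrite /f'; case: eqP => // ji.
      by move: ni; rewrite -ji mem_cat jr orbT.
    have Er2 (h : (T -> R) -> R) : \prod_(j <- r2) h (f' j) = \prod_(j <- r2) h (f j).
      by rewrite big_seq [RHS]big_seq; apply: eq_bigr => j /nr2 ->.
    have f'i : f' i = g by rewrite /f' eqxx.
    rewrite big_cons f'i (Er2 (Ex P)) => E.
    rewrite (_ : Ex P _ = c * Ex P g) ?subrr//.
    rewrite /c -mulrA [X in _ * X]mulrC -E.
    - apply: eq_Ex => w; rewrite big_cons f'i (Er2 (fun h => h w)) /V; ring.
    - by rewrite -(uniq_catCA [:: i]).
    - by [].
    - by move=> j; rewrite /f'; case: eqP => [->|_].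
  rewrite split in H; last by apply: bounded_rv_indic; exact: mA.
  have BA : B i = A i by rewrite /B iJ.
  move/eqP: H; rewrite subr_eq0 => /eqP H.
  rewrite big_cons BA -mulrA [RHS]mulrC -/c -H; apply: eq_Ex => w.
  by rewrite big_cons BA /V; ring.
have uJ : uniq (J ++ [::]) by rewrite cats0 fset_uniq.
have := main J [::] (fun=> fun=> 1) uJ (fun i h => h) K1.
rewrite !big_nil mulr1 => H.
have EB : \bigcap_(i in [set` J]) A i = \bigcap_(i in [set` J]) B i.
  by apply: eq_bigcapr => i /= iJ; rewrite /B iJ.
have mBJ : measurable (\bigcap_(i in [set` J]) B i).
  by apply: fin_bigcap_measurable => //; exact: finite_fset.
rewrite EB Ex_indicE// (_ : Ex P _ = \prod_(i <- J) Ex P (\1_(B i))).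
  rewrite -prodEFin big_seq [RHS]big_seq; apply: eq_bigr => i iJ.
  by rewrite -Ex_indicE// /B iJ.
by rewrite -H; apply: eq_Ex => w; rewrite mulr1 prod_indic.
Qed.

Section process.
Context (I : eqType) (D : set I) (X : I -> T -> nat).
Hypothesis mX : forall t, D t -> measurable_fun setT (X t).

(** Times may repeat in l, so multiplying by one more power stays in the class. *)
Definition power_products : set (T -> R) := [set f | exists l : seq (I * R),
  (forall p, p \in l -> D p.1 /\ 0 <= p.2 <= 1) /\
  f = fun w => \prod_(p <- l) p.2 ^+ X p.1 w].

Definition cylinder (l : seq (I * nat)) : set T :=
  foldr (fun p A => X p.1 @^-1` [set p.2] `&` A) setT l.

Lemma cylinder_cat l1 l2 : cylinder (l1 ++ l2) = cylinder l1 `&` cylinder l2.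
Proof. by elim: l1 => [|p l1 IH] /=; rewrite ?setTI// IH setIA. Qed.

Definition cylinders : set (set T) := [set A | exists l,
  (forall p, p \in l -> D p.1) /\ A = cylinder l].

Lemma measurable_cylinder l : (forall p, p \in l -> D p.1) -> measurable (cylinder l).
Proof.
elim: l => [|p l IH] Dl //=; apply: measurableI.
  by apply: measurable_nat_preimage; apply: mX; apply: Dl; rewrite inE eqxx.
by apply: IH => p' p'l; apply: Dl; rewrite inE p'l orbT.
Qed.

Lemma sigma_of_process_cylinders :
  sigma_of_process D X `<=` <<s cylinders >>.
Proof.
apply: smallest_sub; first exact: smallest_sigma_algebra.
have [s0 sC sU] := smallest_sigma_algebra setT cylinders.
move=> _ [t Dt [A _ <-]]; rewrite setTI.
rewrite (_ : X t @^-1` A = \bigcup_n (if n \in A then X t @^-1` [set n] else set0)); last first.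
  apply/seteqP; split=> [w Aw|w [n _]]; first by exists (X t w) => //; rewrite mem_set.
  by case: ifP => // /set_mem An /= ->.
apply: sU => n; case: ifP => // _; apply: sub_sigma_algebra.
by exists [:: (t, n)]; split=> /= [p|]; [rewrite inE => /eqP-> | rewrite setIT].
Qed.

Lemma power_products_bounded f : power_products f -> bounded_rv f.
Proof.
move=> [l [Hl ->]]; elim: l Hl => [|p l IH] Hl.
  by under eq_fun do rewrite big_nil; exact: bounded_rv_cst.
under eq_fun do rewrite big_cons; apply: bounded_rvM.
  by have [Dp p01] := Hl p (mem_head _ _); apply: bounded_rv_pow => //; exact: mX.
by apply: IH => p' p'l; apply: Hl; rewrite inE p'l orbT.
Qed.

Lemma power_products1 : power_products (fun=> 1).
Proof. by exists [::]; split=> //; apply/funext => w; rewrite big_nil. Qed.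

(** The events of the cylinder are introduced one at a time. The product of W, f and the indicator
    of the remaining cylinder is orthogonal to every power s^(X t), since f times that power is
    again a power product; [gf_determines] then replaces the power by the indicator of X t = n. *)
Lemma power_products_cylinder (W : T -> R) l f : bounded_rv W ->
  (forall g, power_products g -> Ex P (fun w => W w * g w) = 0) ->
  (forall p, p \in l -> D p.1) -> power_products f ->
  Ex P (fun w => W w * f w * \1_(cylinder l) w) = 0.
Proof.
move=> bW HW; elim: l f => [|[t n] l IH] f Dl Kf /=.
  rewrite -[RHS](HW f Kf); apply: eq_Ex => w.
  by rewrite indicE mem_set// mulr1.
have Dt : D t by have := Dl _ (mem_head _ _).
have Dl' p : p \in l -> D p.1 by move=> pl; apply: Dl; rewrite inE pl orbT.
pose V w := W w * f w * \1_(cylinder l) w.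
have bV : bounded_rv V.
  apply: bounded_rvM; first by apply: bounded_rvM => //; exact: power_products_bounded.
  by apply: bounded_rv_indic; exact: measurable_cylinder.
rewrite -[RHS](@gf_determines _ _ _ P _ (mX Dt) _ bV _ n).
  by apply: eq_Ex => w; rewrite indicI /V /=; ring.
move=> s s01; have [fl [Hfl fE]] := Kf.
have := IH (fun w => s ^+ X t w * f w) Dl'.
rewrite (_ : (fun w => V w * s ^+ X t w) =
  (fun w => W w * (s ^+ X t w * f w) * \1_(cylinder l) w)); last first.
  by apply/funext => w; rewrite /V; ring.
apply; exists ((t, s) :: fl); split=> [p|].
  by rewrite inE => /orP[/eqP->|/Hfl].
by apply/funext => w; rewrite big_cons fE.
Qed.

(** The sets with the required property form a lambda-system containing the cylinders, which are
    stable under intersection and generate the sigma-algebra. *)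
Lemma power_products_determine : determines power_products (sigma_of_process D X).
Proof.
move=> A /sigma_of_process_cylinders.
pose H : set (set T) := [set A | measurable A /\ forall W : T -> R, bounded_rv W ->
    (forall f, power_products f -> Ex P (fun w => W w * f w) = 0) ->
    Ex P (fun w => W w * \1_A w) = 0].
suff : <<s cylinders >> `<=` H by apply.
apply: lambda_system_subset => //.
- move=> _ _ [l1 [D1 ->]] [l2 [D2 ->]]; exists (l1 ++ l2); rewrite cylinder_cat; split=> // p.
  by rewrite mem_cat => /orP[/D1|/D2].
- split=> //.
  + split=> // W bW HW; rewrite -[RHS](HW _ power_products1); apply: eq_Ex => w.
    by rewrite indicE mem_set.
  + move=> B C CB [mB HB] [mC HC]; split; first exact: measurableD.
    move=> W bW HW.
    have -> : (fun w => W w * \1_(B `\` C) w) = (fun w => W w * \1_B w - W w * \1_C w).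
      apply/funext => w; rewrite -mulrBr !indicE in_setD; congr (_ * _).
      have [/set_mem /CB Bw|_] := boolP (w \in C); first by rewrite (mem_set Bw) subrr.
      by rewrite andbT subr0.
    rewrite ExB ?HB ?HC ?subrr//; apply: bounded_rvM => //; exact: bounded_rv_indic.
  + move=> F ndF HF.
    have mF n : measurable (F n) by have [] := HF n.
    split; first exact: bigcup_measurable.
    move=> W bW HW; have [_ [C HC]] := bW.
    have [||w|_] := @bounded_cvg_Ex _ _ _ P (fun n w => W w * \1_(F n) w)
      (fun w => W w * \1_(\bigcup_i F i) w) C.
    * by move=> n; apply: bounded_rvM => //; exact: bounded_rv_indic.
    * move=> n w; rewrite normrM -[leRHS]mulr1; apply: ler_pM => //.
      by rewrite indicE normr_nat lern1 leq_b1.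
    * apply: cvgM; first exact: cvg_cst.
      have [[n _ Fn]|nF] := pselect ((\bigcup_i F i) w).
        rewrite indicE mem_set; last by exists n.
        apply: cvg_near_cst; exists n => // m /= nm.
        by rewrite indicE mem_set//; have /subsetPset := ndF _ _ nm; exact.
      rewrite indicE memNset//; apply: cvg_near_cst; exists 0%N => // m _.
      by rewrite indicE memNset// => Fm; apply: nF; exists m.
    * move/cvg_lim => <-//.
      rewrite (_ : (fun n => _) = (fun=> 0)) ?lim_cst//.
      by apply/funext => n; have [_] := HF n; apply.
- move=> _ [l [Dl ->]]; split; first exact: measurable_cylinder.
  move=> W bW HW.
  rewrite -[RHS](@power_products_cylinder W l (fun=> 1) bW HW Dl power_products1).
  by apply: eq_Ex => w; rewrite mulr1.
Qed.

End process.

Lemma sigma_of_in_process (I : Type) (E : Type) (D : set I) (X : I -> T -> E) (t : I) :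
  D t -> sigma_of (X t) `<=` sigma_of_process D X.
Proof. by move=> Dt A XA; apply: sub_sigma_algebra; exists t. Qed.

End determining_classes.

(** * Exact expectation of the cell weights *)

Section cells.
Context (R : realType) (q : nat).

(* [dd c] is the increment over the cell [c] and [e n] the outcome of the roll
   [n]; every nonzero increment consumes one roll, the next one being [n]. *)
Fixpoint cell_weight (dd : nat -> nat) (e : nat -> 'I_q) (c n : nat)
    (cs : seq ('I_q -> R)) : R :=
  if cs is s :: cs' then
    if dd c == 0%N then cell_weight dd e c.+1 n cs'
    else s (e n) ^+ dd c * cell_weight dd e c.+1 n.+1 cs'
  else 1.

Context d (T : measurableType d) (P : probability T R).
Variables (D : nat -> T -> nat) (xi : nat -> T -> 'I_q) (p : 'I_q -> R).
Hypothesis mD : forall c, measurable_fun setT (D c).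
Hypothesis mxi : forall n i, measurable (xi n @^-1` [set i]).
Hypothesis p1 : \sum_(i < q) p i = 1.

Lemma Ex_partition (Y : T -> nat) (V : T -> R) : measurable_fun setT Y -> bounded_rv V ->
  (\sum_(n < m) Ex P (fun w => V w * \1_(Y @^-1` [set val n]) w)) @[m --> \oo] --> Ex P V.
Proof.
move=> mY bV; have [_ [C HC]] := bV.
have bI n : bounded_rv (fun w => V w * \1_(Y @^-1` [set n]) w).
  apply: bounded_rvM => //; apply: bounded_rv_indic; exact: measurable_nat_preimage.
pose F m w := \sum_(n < m) V w * \1_(Y @^-1` [set val n]) w.
have FE m w : F m w = if (Y w < m)%N then V w else 0.
  rewrite /F -big_distrr /=; case: ifP => Ym.
    rewrite (bigD1 (Ordinal Ym))//= big1 ?addr0; first by rewrite indicE mem_set// mulr1.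
    move=> n /eqP nY; rewrite indicE memNset//= => E; apply: nY.
    by apply: val_inj.
  by rewrite big1 ?mulr0// => n _; rewrite indicE memNset//= => E; move: Ym; rewrite E ltn_ord.
have [| | |_] := @bounded_cvg_Ex _ _ _ P F V C.
- by move=> m; apply: bounded_rv_sum => n; exact: bI.
- by move=> m w; rewrite FE; case: ifP => // _; rewrite normr0 (le_trans _ (HC w)).
- move=> w; apply: cvg_near_cst; exists (Y w).+1 => // m /= Ym.
  by rewrite FE Ym.
apply: cvg_trans; apply: near_eq_cvg; apply: nearW => m.
by rewrite -[RHS]Ex_sum.
Qed.

(** A fully revealed past: the next cell is [size ds] and the next roll [size es], the two arguments
    of [cell_weight]. *)
Definition cell_event (ds : seq nat) (es : seq 'I_q) : set T :=
  [set w | mkseq (D ^~ w) (size ds) = ds /\ mkseq (xi ^~ w) (size es) = es].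

Lemma cell_event_rconsl ds n es :
  cell_event (rcons ds n) es = cell_event ds es `&` D (size ds) @^-1` [set n].
Proof.
apply/seteqP; split=> w; rewrite /cell_event /= size_rcons mkseqS.
  by move=> [/rcons_inj [-> ->]].
by move=> [[h ->] ->]; rewrite h.
Qed.

Lemma cell_event_rconsr ds i es :
  cell_event ds (rcons es i) = cell_event ds es `&` xi (size es) @^-1` [set i].
Proof.
apply/seteqP; split=> w; rewrite /cell_event /= size_rcons mkseqS.
  by move=> [-> /rcons_inj [-> ->]].
by move=> [[-> h] ->]; rewrite h.
Qed.

Lemma measurable_cell_event ds es : measurable (cell_event ds es).
Proof.
elim/last_ind: ds => [|ds n IH]; last first.
  by rewrite cell_event_rconsl; apply: measurableI => //; exact: measurable_nat_preimage.
elim/last_ind: es => [|es i IH]; last by rewrite cell_event_rconsr; exact: measurableI.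
by rewrite (_ : cell_event _ _ = setT)//; apply/seteqP; split.
Qed.

Let Z c n cs w := cell_weight (D ^~ w) (xi ^~ w) c n cs.
Let weights01 (cs : seq ('I_q -> R)) :=
  List.Forall (fun s : 'I_q -> R => forall i, 0 <= s i <= 1) cs.

Lemma sum_face_indic n w (f : 'I_q -> R) :
  \sum_i \1_(xi n @^-1` [set i]) w * f i = f (xi n w).
Proof.
rewrite (bigD1 (xi n w))//= big1 ?addr0; first by rewrite indicE mem_set// mul1r.
by move=> i /eqP ni; rewrite indicE memNset ?mul0r// => /= E; apply: ni.
Qed.

Lemma bounded_cell_weight c n cs : weights01 cs -> bounded_rv (Z c n cs).
Proof.
elim: cs c n => [|s cs IH] c n Hs /=; first exact: bounded_rv_cst.
have Hs0 : forall i, 0 <= s i <= 1 by inversion Hs.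
have Hs' : weights01 cs by inversion Hs.
have bD0 : bounded_rv (\1_(D c @^-1` [set 0%N]) : T -> R).
  by apply: bounded_rv_indic; exact: measurable_nat_preimage.
(* Writing the randomly selected weight s (xi n) as a sum of indicators over the faces makes
   measurability visible. *)
rewrite (_ : Z c n _ = (fun w => \1_(D c @^-1` [set 0%N]) w * Z c.+1 n cs w +
   (1 - \1_(D c @^-1` [set 0%N]) w) *
   ((\sum_i \1_(xi n @^-1` [set i]) w * s i ^+ D c w) * Z c.+1 n.+1 cs w))).
  apply: bounded_rvD; first by apply: bounded_rvM => //; exact: IH.
  apply: bounded_rvM; first by apply: bounded_rvB => //; exact: bounded_rv_cst.
  apply: bounded_rvM; last exact: IH.
  apply: bounded_rv_sum => i; apply: bounded_rvM; first exact: bounded_rv_indic.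
  exact: bounded_rv_pow.
apply/funext => w; rewrite sum_face_indic {1}/Z /= indicE.
case: eqP => D0; first by rewrite mem_set//; rewrite mul1r subrr mul0r addr0.
by rewrite memNset// mul0r add0r subr0 mul1r.
Qed.

Let G (s : R) := Ex P (fun w => s ^+ D 0 w).
Let S (s : 'I_q -> R) := \sum_i p i * G (s i).

Hypothesis cell_eventE : forall ds es, Ex P (\1_(cell_event ds es)) =
  \prod_(n <- ds) Ex P (\1_(D 0 @^-1` [set n])) * \prod_(i <- es) p i.

(** Induction on the remaining cells, for an arbitrary revealed past. Splitting by the value n of
    the next increment, and for n > 0 also by the next face, extends the past; [cell_eventE]
    supplies the factors, and summing over n gives [S s]. *)
Lemma Ex_cell_weight ds es cs : weights01 cs ->
  Ex P (fun w => \1_(cell_event ds es) w * Z (size ds) (size es) cs w) =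
  Ex P (\1_(cell_event ds es)) * \prod_(s <- cs) S s.
Proof.
elim: cs ds es => [|s cs IH] ds es Hs.
  by rewrite big_nil mulr1; apply: eq_Ex => w; rewrite mulr1.
have Hs0 : forall i, 0 <= s i <= 1 by inversion Hs.
have Hs' : weights01 cs by inversion Hs.
set B := cell_event ds es; set Q := \prod_(s <- cs) S s.
pose pi n := Ex P (\1_(D 0 @^-1` [set n])).
have bB ds' es' : bounded_rv (\1_(cell_event ds' es') : T -> R).
  by apply: bounded_rv_indic; exact: measurable_cell_event.
have bV : bounded_rv (fun w => \1_B w * Z (size ds) (size es) (s :: cs) w).
  by apply: bounded_rvM; [exact: bB | exact: bounded_cell_weight].
have term n : Ex P (fun w => (\1_B w * Z (size ds) (size es) (s :: cs) w) *
    \1_(D (size ds) @^-1` [set n]) w) = Ex P (\1_B) * Q * \sum_i p i * (s i ^+ n * pi n).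
  have E0 : Ex P (\1_(cell_event (rcons ds n) es)) = Ex P (\1_B) * pi n.
    by rewrite !cell_eventE -cats1 big_cat big_seq1 mulrAC.
  (* A zero increment consumes no roll, but the formula is the same because s^0 = 1 and the p i sum
     to 1. *)
  have [n0|n0] := eqVneq n 0%N.
    under eq_bigr => i _ do rewrite n0 expr0 mul1r -n0.
    rewrite -mulr_suml p1 mul1r mulrAC -E0.
    have := IH (rcons ds n) es Hs'; rewrite size_rcons => <-.
    apply: eq_Ex => w; rewrite n0 cell_event_rconsl indicI /=.
    rewrite -/B [in LHS]/Z /= [\1_(D _ @^-1` _) w]indicE; case: eqP => Dw; last first.
      by rewrite !(memNset (_ : ~ (D (size ds) @^-1` [set 0%N]) w))// ?mulr0 ?mul0r.
    by rewrite (mem_set (_ : (D (size ds) @^-1` [set 0%N]) w))//= !mulr1.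
  transitivity (\sum_i s i ^+ n * (Ex P (\1_(cell_event (rcons ds n) (rcons es i))) * Q)).
    pose F i w := s i ^+ n * (\1_(cell_event (rcons ds n) (rcons es i)) w *
      Z (size (rcons ds n)) (size (rcons es i)) cs w).
    have bZ i : bounded_rv (fun w => \1_(cell_event (rcons ds n) (rcons es i)) w *
        Z (size (rcons ds n)) (size (rcons es i)) cs w).
      by apply: bounded_rvM; [exact: bB | exact: bounded_cell_weight].
    have bF i : bounded_rv (F i) by apply: bounded_rvM; [exact: bounded_rv_cst|exact: bZ].
    transitivity (\sum_i Ex P (F i)); last first.
      by apply: eq_bigr => i _; rewrite -IH// -ExZ.
    rewrite -Ex_sum//; apply: eq_Ex => w; rewrite /F.
    have CE i : \1_(cell_event (rcons ds n) (rcons es i)) w =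
        \1_B w * \1_(D (size ds) @^-1` [set n]) w * \1_(xi (size es) @^-1` [set i]) w :> R.
      by rewrite cell_event_rconsr indicI /= cell_event_rconsl indicI.
    rewrite /Z /= (_ : \sum_i _ = \sum_i \1_(xi (size es) @^-1` [set i]) w *
      (s i ^+ n * \1_B w * \1_(D (size ds) @^-1` [set n]) w *
      cell_weight (D^~ w) (xi^~ w) (size ds).+1 (size es).+1 cs)); last first.
      by apply: eq_bigr => i _; rewrite CE !size_rcons; ring.
    rewrite sum_face_indic [\1_(D _ @^-1` _) w]indicE.
    case: (eqVneq (D (size ds) w) n) => Dw; last first.
      by rewrite (memNset (_ : ~ (D (size ds) @^-1` [set n]) w)) ?mulr0 ?mul0r//=; exact/eqP.
    rewrite (mem_set (_ : (D (size ds) @^-1` [set n]) w))//= Dw (negPf n0); ring.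
  rewrite big_distrr /=; apply: eq_bigr => i _.
  rewrite !cell_eventE -!cats1 !big_cat !big_seq1 /= -/(pi n); ring.
have cV := Ex_partition (mD (size ds)) bV.
rewrite big_cons -/Q [S s * Q]mulrC mulrA -(cvg_lim (@norm_hausdorff _ _) cV).
apply: cvg_lim => //.
under eq_cvg do (under eq_bigr do rewrite term; rewrite -big_distrr /= exchange_big /=).
apply: cvgM; first exact: cvg_cst.
apply: cvg_sum_seq => i; under eq_cvg do rewrite -big_distrr /=.
apply: cvgM; first exact: cvg_cst.
have := Ex_partition (mD 0) (bounded_rv_pow (mD 0) (Hs0 i)); apply: cvg_trans.
apply: near_eq_cvg; apply: nearW => m; apply: eq_bigr => n _.
rewrite -ExZ; last by apply: bounded_rv_indic; exact: measurable_nat_preimage.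
apply: eq_Ex => w; rewrite indicE.
have [/set_mem /= ->//|_] := boolP (w \in _); by rewrite !mulr0.
Qed.

Lemma Ex_cell_weight0 cs : weights01 cs ->
  Ex P (Z 0 0 cs) = \prod_(s <- cs) S s.
Proof.
move=> Hs; have := Ex_cell_weight [::] [::] Hs; rewrite cell_eventE !big_nil !mul1r => <-.
by apply: eq_Ex => w; rewrite indicE mem_set// mul1r.
Qed.

End cells.

(** * Exponential limits and rounding to the mesh *)

Section limits.
Context (R : realType).

Lemma littleo_id_cvg (f : R -> R) :
  f =o_ (0^'+) (fun h : R => h) <-> f h / h @[h --> 0^'+] --> (0 : R).
Proof.
split=> [/eqoP H|H].
  apply/cvgr0Pnorm_le => e e0; near=> h.
  have h0 : 0 < h by near: h; exact: nbhs_right_gt.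
  rewrite normrM normfV ler_pdivrMr ?normr_gt0 ?gt_eqF//.
  by near: h; exact: H.
apply/eqoP => e e0; move/cvgr0Pnorm_le: H => /(_ e e0) H; near=> h.
have h0 : 0 < h by near: h; exact: nbhs_right_gt.
rewrite -ler_pdivrMr ?normr_gt0 ?gt_eqF// -normfV -normrM.
by near: h; exact: H.
Unshelve. all: by end_near. Qed.

(** For a > 0, exp (- (1 - a) / a) <= a <= exp (- (1 - a)): both bounds are 1 + x <= exp x, at x =
    (1 - a) / a and at x = a - 1. Their m-th powers have the same limit. *)
Lemma pow_cvg_exp (a : nat -> R) (m : nat -> nat) (psi delta : R) :
  (forall n, 0 <= a n <= 1) ->
  n.+1%:R * (1 - a n) @[n --> \oo] --> psi ->
  (m n)%:R / n.+1%:R @[n --> \oo] --> delta ->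
  a n ^+ m n @[n --> \oo] --> expR (- (delta * psi)).
Proof.
move=> a01 Ha Hm.
have a1 : a n @[n --> \oo] --> (1 : R).
  rewrite [X in _ --> X](_ : 1 = 1 - psi * 0); last by rewrite mulr0 subr0.
  rewrite (_ : a = fun n => 1 - n.+1%:R * (1 - a n) * n.+1%:R^-1); last first.
    by apply/funext => n; rewrite mulrAC divff ?mul1r ?subKr.
  by apply: cvgB; [exact: cvg_cst | apply: cvgM => //; exact: cvg_harmonic].
have Hu : (m n)%:R * (1 - a n) @[n --> \oo] --> delta * psi.
  rewrite (_ : (fun n => _) = fun n => (m n)%:R / n.+1%:R * (n.+1%:R * (1 - a n))).
    exact: cvgM.
  by apply/funext => n; rewrite mulrA divfK.
have HU : (m n)%:R * (1 - a n) / a n @[n --> \oo] --> delta * psi.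
  rewrite (_ : delta * psi = delta * psi * 1^-1); last by rewrite invr1 mulr1.
  by apply: cvgM => //; apply: cvgV => //; exact: oner_neq0.
apply: (squeeze_cvgr (f := fun n => expR (- ((m n)%:R * (1 - a n) / a n)))
    (h := fun n => expR (- ((m n)%:R * (1 - a n))))).
- have /cvgr_gt/(_ _ (@ltr01 R)) : a n @[n --> \oo] --> (1 : R) by [].
  apply: filterS => n an0; apply/andP; split.
    have := a01 n => /andP[_ an1].
    rewrite -mulrA -mulrN expRM_natl lerXn2r ?nnegrE ?expR_ge0 ?(ltW an0)//.
    rewrite expRN -[leRHS]invrK lef_pV2 ?posrE ?expR_gt0 ?invr_gt0//.
    apply: le_trans (expR_ge1Dx _).
    by rewrite mulrBl divff ?gt_eqF// mul1r addrC subrK.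
  rewrite -mulrN expRM_natl lerXn2r ?nnegrE ?expR_ge0 ?(ltW an0)//.
  by apply: le_trans (expR_ge1Dx _); rewrite opprB addrC subrK.
- by apply: continuous_cvg; [exact: continuous_expR | exact: cvgN].
- by apply: continuous_cvg; [exact: continuous_expR | exact: cvgN].
Unshelve. all: by end_near. Qed.

Lemma expR_rate (psi : R) : 0 <= psi ->
  (1 - expR (- (h * psi))) / h @[h --> 0^'+] --> psi.
Proof.
move=> psi0.
apply: (squeeze_cvgr (f := fun h => psi / (1 + h * psi)) (h := fun=> psi)).
- near=> h; have h0 : 0 < h by near: h; exact: nbhs_right_gt.
  have hp : 0 <= h * psi by rewrite mulr_ge0// ltW.
  have hp1 : 0 < 1 + h * psi by rewrite ltr_wpDr.
  apply/andP; split.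
    rewrite ler_pdivlMr// expRN.
    have : (expR (h * psi))^-1 <= (1 + h * psi)^-1.
      by rewrite lef_pV2 ?posrE ?expR_gt0// expR_ge1Dx.
    move=> H; apply: le_trans (lerB (lexx 1) H).
    rewrite le_eqVlt; apply/orP; left; apply/eqP; field; exact: lt0r_neq0.
  rewrite ler_pdivrMr//; have := expR_ge1Dx (- (h * psi)); lra.
- rewrite [X in _ --> X](_ : psi = psi * (1 + 0 * psi)^-1); last first.
    by rewrite mul0r addr0 invr1 mulr1.
  apply: cvgM; first exact: cvg_cst.
  apply: cvgV; first by rewrite mul0r addr0 oner_neq0.
  apply: cvgD; first exact: cvg_cst.
  apply: cvgM; last exact: cvg_cst.
  by apply: cvg_at_right_filter; exact: cvg_id.
- exact: cvg_cst.
Unshelve. all: by end_near. Qed.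

(** The successor rounds strictly upwards, so that the mesh point tends to t from the right, where
    the path is constant. *)
Definition grid (n : nat) (t : R) : nat := (Num.truncn (t * n.+1%:R)).+1.

Lemma grid_gt n t : 0 <= t -> t < (grid n t)%:R / n.+1%:R.
Proof.
move=> t0; rewrite ltr_pdivlMr//.
by have /truncn_itv/andP[] : 0 <= t * n.+1%:R by rewrite mulr_ge0.
Qed.

Lemma grid_le n t : 0 <= t -> (grid n t)%:R / n.+1%:R <= t + n.+1%:R^-1.
Proof.
move=> t0; rewrite ler_pdivrMr// mulrDl mulVf// -[leLHS]natr1 lerD2r.
by have /truncn_itv/andP[] : 0 <= t * n.+1%:R by rewrite mulr_ge0.
Qed.

Lemma grid_mono n s t : 0 <= s -> s <= t -> (grid n s <= grid n t)%N.
Proof.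
by move=> s0 st; rewrite ltnS; apply: le_truncn; rewrite ler_wpM2r.
Qed.

Lemma grid_cvg t : 0 <= t -> (grid n t)%:R / n.+1%:R @[n --> \oo] --> t.
Proof.
move=> t0; apply: (squeeze_cvgr (f := fun=> t) (h := fun n => t + n.+1%:R^-1)).
- by apply: nearW => n; rewrite ltW ?grid_gt//= grid_le.
- exact: cvg_cst.
- rewrite -[X in _ --> X]addr0; apply: cvgD; [exact: cvg_cst|exact: cvg_harmonic].
Qed.

Lemma grid_diff_cvg s t : 0 <= s -> s <= t ->
  (grid n t - grid n s)%:R / n.+1%:R @[n --> \oo] --> t - s.
Proof.
move=> s0 st; rewrite (_ : (fun n => _) =
    fun n => (grid n t)%:R / n.+1%:R - (grid n s)%:R / n.+1%:R).
  by apply: cvgB; apply: grid_cvg => //; exact: le_trans st.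
by apply/funext => n; rewrite natrB ?grid_mono// mulrBl.
Qed.

End limits.

(** * Jump rates and exponents of generating functions *)

Section rates.
Context (R : realType) (k : nat).
Implicit Types mu : 'I_k -> R.

(** The compound Poisson exponent: exp (- t cumulant) is the generating function at time t for jump
    rates mu. *)
Definition cumulant mu (s : R) : R := \sum_j mu j * (1 - s ^+ j.+1).

(** The coefficient of s^n in cumulant 0 - cumulant s; it is 0 for n = 0 and for n > k. *)
Definition jump_rate mu (n : nat) : R := \sum_j mu j * (n == j.+1)%:R.

Lemma cumulant0 mu : cumulant mu 0 = \sum_j mu j.
Proof. by apply: eq_bigr => j _; rewrite expr0n /= subr0 mulr1. Qed.

Lemma cumulant_ge0 mu s : (forall j, 0 <= mu j) -> 0 <= s <= 1 -> 0 <= cumulant mu s.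
Proof.
move=> mu0 /andP[s0 s1]; apply: sumr_ge0 => j _.
by rewrite mulr_ge0// subr_ge0 exprn_ile1.
Qed.

Lemma jump_rateS mu (j : 'I_k) : jump_rate mu j.+1 = mu j.
Proof.
rewrite /jump_rate (bigD1 j)//= eqxx mulr1 big1 ?addr0// => i /eqP ij.
case: eqP => [[/ord_inj ji]|]; [by case: ij|by rewrite mulr0].
Qed.

Lemma jump_rate_large mu n : (k < n)%N -> jump_rate mu n = 0.
Proof.
move=> kn; rewrite /jump_rate big1// => i _; case: eqP => [E|]; last by rewrite mulr0.
by move: kn; rewrite E ltnS leqNgt ltn_ord.
Qed.

Lemma jump_rate_expands mu : (forall j, 0 <= mu j) ->
  expands (jump_rate mu) (fun s => cumulant mu 0 - cumulant mu s) (\sum_j mu j).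
Proof.
move=> mu0 s m /andP[s0 s1].
rewrite cumulant0 /cumulant -sumrB.
under [X in _ - X]eq_bigr do rewrite mulr_suml.
rewrite exchange_big /= -sumrB mulr_suml; apply: le_trans (ler_norm_sum _ _ _) _.
apply: ler_sum => j _.
under eq_bigr do rewrite -mulrA.
rewrite -mulr_sumr (_ : \sum_(i < m) _ = if (j.+1 < m)%N then s ^+ j.+1 else 0); last first.
  case: ifP => jm.
    rewrite (bigD1 (Ordinal jm))//= eqxx mul1r big1 ?addr0// => i /eqP ij.
    by case: eqP => [E|]; [case: ij; exact: val_inj|rewrite mul0r].
  rewrite big1// => i _; case: eqP => [E|]; last by rewrite mul0r.
  by move: jm; rewrite -E ltn_ord.
case: ifP => jm; rewrite mulrBr mulr1 subKr ?subrr ?normr0; first by rewrite mulr_ge0// exprn_ge0.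
rewrite mulr0 subr0 normrM !ger0_norm ?exprn_ge0//; apply: ler_wpM2l => //.
by apply: ler_wiXn2l => //; rewrite leqNgt jm.
Qed.

Context d (T : measurableType d) (P : probability T R).

Let prob (Y : T -> nat) n := Ex P (\1_(Y @^-1` [set n])).

(** In contrast to [gf_expands], the remainder is controlled by P (Y >= m), which in [gf_rate] is
    small compared with h. *)
Lemma gf_tail (Y : T -> nat) (s : R) m : measurable_fun setT Y -> 0 <= s <= 1 ->
  `|Ex P (fun w => s ^+ Y w) - \sum_(n < m) prob Y n * s ^+ n| <= 1 - \sum_(n < m) prob Y n.
Proof.
move=> mY s01; have /andP[s0 s1] := s01.
have bI n : bounded_rv (\1_(Y @^-1` [set n]) : T -> R).
  by apply: bounded_rv_indic; exact: measurable_nat_preimage.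
have bs := bounded_rv_pow mY s01.
have bIs n : bounded_rv (fun w => s ^+ n * \1_(Y @^-1` [set n]) w).
  by apply: bounded_rvM => //; exact: bounded_rv_cst.
have -> : \sum_(n < m) prob Y n * s ^+ n =
    Ex P (fun w => \sum_(n < m) s ^+ n * \1_(Y @^-1` [set val n]) w).
  rewrite Ex_sum => [|n]; last exact: bIs.
  by apply: eq_bigr => n _; rewrite ExZ// mulrC.
rewrite -Ex_sum => [|n]; last exact: bI.
rewrite -[X in _ <= X - _](Ex_cst P) -!ExB//.
- apply: norm_Ex_le_Ex.
  + by apply: bounded_rvB => //; apply: bounded_rv_sum => n; exact: bIs.
  + by apply: bounded_rvB; [exact: bounded_rv_cst|apply: bounded_rv_sum => n; exact: bI].
  move=> w; have E (f : nat -> R) : \sum_(n < m) f n * \1_(Y @^-1` [set val n]) w =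
      if (Y w < m)%N then f (Y w) else 0.
    case: ifPn => Ym.
      rewrite (bigD1 (Ordinal Ym))//= big1 ?addr0; first by rewrite indicE mem_set// mulr1.
      by move=> n /eqP nY; rewrite indicE memNset ?mulr0//= => E; apply: nY; exact: val_inj.
    by rewrite big1// => n _; rewrite indicE memNset ?mulr0//= => E; move: Ym; rewrite E ltn_ord.
  rewrite (E (fun n => s ^+ n)); under [X in _ <= _ - X]eq_bigr do rewrite -[\1_ _ _]mul1r.
  rewrite (E (fun=> 1)); case: ifP => _; rewrite ?subrr ?normr0// !subr0.
  by rewrite ger0_norm ?exprn_ge0// exprn_ile1.
- exact: bounded_rv_cst.
- by apply: bounded_rv_sum => n; exact: bI.
- by apply: bounded_rv_sum => n; exact: bIs.
Qed.

(** Separate o(h) estimates for each amplitude above k would not bound their sum. The whole tail is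
    o(h) because it is 1 minus the probabilities of 0, ..., k, whose rates cancel; this is [r0]. *)
Lemma gf_rate (Y : R -> T -> nat) mu (s : R) :
  (forall h, 0 <= h -> measurable_fun setT (Y h)) -> 0 <= s <= 1 ->
  (1 - prob (Y h) 0) / h @[h --> 0^'+] --> \sum_j mu j ->
  (forall j : 'I_k, prob (Y h) j.+1 / h @[h --> 0^'+] --> mu j) ->
  (1 - Ex P (fun w => s ^+ Y h w)) / h @[h --> 0^'+] --> cumulant mu s.
Proof.
move=> mY s01 H0 HS.
pose r h := (1 - \sum_(n < k.+1) prob (Y h) n) / h.
pose a h := (1 - \sum_(n < k.+1) prob (Y h) n * s ^+ n) / h.
have r0 : r h @[h --> 0^'+] --> (0 : R).
  rewrite (_ : r = fun h => (1 - prob (Y h) 0) / h - \sum_(j < k) prob (Y h) j.+1 / h).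
    by rewrite -[X in _ --> X](subrr (\sum_j mu j)); apply: cvgB => //; exact: cvg_sum_seq.
  by apply/funext => h; rewrite /r big_ord_recl opprD addrA mulrBl mulr_suml.
have a0 : a h @[h --> 0^'+] --> cumulant mu s.
  rewrite (_ : a = fun h => (1 - prob (Y h) 0) / h - \sum_(j < k) prob (Y h) j.+1 / h * s ^+ j.+1).
    rewrite (_ : cumulant mu s = \sum_j mu j - \sum_j mu j * s ^+ j.+1); last first.
      by rewrite /cumulant -sumrB; apply: eq_bigr => j _; rewrite mulrBr mulr1.
    apply: cvgB => //; apply: cvg_sum_seq => j; apply: cvgM; [exact: HS|exact: cvg_cst].
  apply/funext => h; rewrite /a big_ord_recl expr0 mulr1 opprD addrA mulrBl mulr_suml.
  by congr (_ - _); apply: eq_bigr => j _; rewrite mulrAC.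
have H h : 0 < h -> a h - r h <= (1 - Ex P (fun w => s ^+ Y h w)) / h <= a h + r h.
  move=> h0; have := gf_tail k.+1 (mY h (ltW h0)) s01.
  rewrite ler_norml /a /r -mulrBl -mulrDl !ler_pM2r ?invr_gt0// => /andP[h1 h2].
  by apply/andP; split; lra.
apply: (squeeze_cvgr (f := fun h => a h - r h) (h := fun h => a h + r h)).
- near=> h; apply: H; near: h; exact: nbhs_right_gt.
- by rewrite -[X in _ --> X]subr0; apply: cvgB.
- by rewrite -[X in _ --> X]addr0; apply: cvgD.
Unshelve. all: by end_near. Qed.

Lemma exp_gf_rates (Y : R -> T -> nat) mu :
  (forall h, 0 <= h -> measurable_fun setT (Y h)) -> (forall j, 0 <= mu j) ->
  (forall h s, 0 <= h -> 0 <= s <= 1 ->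
     Ex P (fun w => s ^+ Y h w) = expR (- (h * cumulant mu s))) ->
  (1 - prob (Y h) 0) / h @[h --> 0^'+] --> \sum_j mu j /\
  (forall n, prob (Y h) n.+1 / h @[h --> 0^'+] --> jump_rate mu n.+1).
Proof.
move=> mY mu0 HG.
(* At s = 0 the power is the indicator of Y h = 0, as 0^0 = 1. *)
have b0 h : 0 <= h -> prob (Y h) 0 = expR (- (h * cumulant mu 0)).
  move=> h0; rewrite -HG ?lexx ?ler01//; apply: eq_Ex => w; rewrite indicE expr0n.
  case: eqP => E; first by rewrite mem_set.
  by rewrite memNset.
have c0 : 0 <= cumulant mu 0 by apply: cumulant_ge0 => //; rewrite lexx ler01.
split.
  rewrite -cumulant0; have := expR_rate c0; apply: cvg_trans; apply: near_eq_cvg.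
  by near=> h; rewrite b0//; near: h; exact: nbhs_right_ge.
(* Restricting to the event Y h <> 0, of probability O(h), makes the remainders
   of the expansion O(h) uniformly, so that they survive the division by h. *)
pose W h : T -> R := fun w => 1 - \1_(Y h @^-1` [set 0%N]) w.
pose b h n := Ex P (fun w => W h w * \1_(Y h @^-1` [set n]) w) / h.
pose g h s := Ex P (fun w => W h w * s ^+ Y h w) / h.
have bI h n : 0 <= h -> bounded_rv (\1_(Y h @^-1` [set n]) : T -> R).
  by move=> h0; apply: bounded_rv_indic; apply: measurable_nat_preimage; exact: mY.
have bW h : 0 <= h -> bounded_rv (W h).
  by move=> h0; apply: bounded_rvB; [exact: bounded_rv_cst|exact: bI].
have EW h : 0 <= h -> Ex P (fun w => `|W h w|) <= h * cumulant mu 0.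
  move=> h0; rewrite (_ : Ex P _ = 1 - prob (Y h) 0).
    by rewrite b0//; have := expR_ge1Dx (- (h * cumulant mu 0)); lra.
  rewrite -(Ex_cst P 1) -ExB//; [|exact: bounded_rv_cst|exact: bI].
  apply: eq_Ex => w; rewrite ger0_norm// subr_ge0 indicE.
  by rewrite lern1 leq_b1.
have Hb : \forall h \near 0^'+, expands (b h) (g h) (cumulant mu 0).
  near=> h; have h0 : 0 < h by near: h; exact: nbhs_right_gt.
  move=> s m s01; have := gf_expands P (mY h (ltW h0)) (bW h (ltW h0)) m s01.
  rewrite /b /g; under [X in _ -> `|_ - X| <= _]eq_bigr do rewrite mulrAC.
  rewrite -mulr_suml -mulrBl normrM normfV (gtr0_norm h0) ler_pdivrMr// => H.
  apply: le_trans H _; rewrite mulrAC; apply: ler_wpM2r; last by rewrite mulrC EW// ltW.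
  by case/andP: s01 => s0 _; rewrite exprn_ge0.
(* Removing the event Y h = 0 gives g h s = (E s^(Y h) - P (Y h = 0)) / h, a difference of two
   quotients treated by [expR_rate]. *)
have Hg s : 0 < s <= 1 -> (g h s - (cumulant mu 0 - cumulant mu s)) @[h --> 0^'+] --> (0 : R).
  move=> /andP[s0 s1]; have s01 : 0 <= s <= 1 by rewrite ltW.
  rewrite -[X in _ --> X](subrr (cumulant mu 0 - cumulant mu s)).
  apply: cvgB; last exact: cvg_cst.
  apply: cvg_trans (cvgB (expR_rate c0) (expR_rate (cumulant_ge0 mu0 s01))).
  apply: near_eq_cvg; near=> h; have h0 : 0 < h by near: h; exact: nbhs_right_gt.
  have subE (u v : R) : 1 - u - (1 - v) = v - u by ring.
  transitivity ((1 - expR (- (h * cumulant mu 0))) / h -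
    (1 - expR (- (h * cumulant mu s))) / h) => //.
  rewrite -mulrBl subE /g -(b0 _ (ltW h0)) -(HG _ _ (ltW h0) s01).
  congr (_ / h); rewrite /prob -ExB; last 2 first.
    by apply: bounded_rv_pow => //; apply: mY; exact: ltW.
    exact/bI/ltW.
  apply: eq_Ex => w; rewrite /W mulrBl mul1r indicE.
  have [/set_mem /= ->|_] := boolP (w \in _); first by rewrite expr0 mulr1.
  by rewrite mul0r.
have Hb' : \forall h \near 0^'+, expands (fun n => b h n - jump_rate mu n)
     (fun s => g h s - (cumulant mu 0 - cumulant mu s)) (cumulant mu 0 + \sum_j mu j).
  by apply: filterS Hb => h1 Hb1; apply: expandsB => //; exact: jump_rate_expands.
move=> n; have H0 : (b h n.+1 - jump_rate mu n.+1) @[h --> 0^'+] --> (0 : R).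
  exact: (coef_cvg0 Hb' Hg).
have H1 : (b h n.+1 - jump_rate mu n.+1 + jump_rate mu n.+1) @[h --> 0^'+] --> jump_rate mu n.+1.
  by rewrite -[X in _ --> X]add0r; apply: cvgD => //; exact: cvg_cst.
apply: cvg_trans H1.
apply: near_eq_cvg; near=> h; rewrite [LHS]subrK /b; congr (_ / h); apply: eq_Ex => w.
rewrite /W !indicE.
have [/set_mem /= E|_] := boolP (w \in Y h @^-1` [set n.+1]); last by rewrite mulr0.
by rewrite memNset ?subr0 ?mulr1//= E.
Unshelve. all: by end_near. Qed.

End rates.

(** * Measurability of integer-valued functions *)

Section measurable_nat_functions.

Lemma measurable_nat2 d (T : measurableType d) (f g : T -> nat) (h : nat -> nat -> nat) :
  measurable_fun setT f -> measurable_fun setT g ->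
  measurable_fun setT (fun w => h (f w) (g w)).
Proof.
move=> mf mg _ A _; rewrite setTI.
rewrite (_ : _ @^-1` A =
    \bigcup_a (f @^-1` [set a] `&` g @^-1` [set b | A (h a b)])); last first.
  by apply/seteqP; split=> [w Aw|w [a _ [/= ->]]//]; exists (f w).
by apply: bigcup_measurable => a _; apply: measurableI; exact: measurable_nat_preimage.
Qed.

(** Turns membership in the generated sigma-algebra into measurability over another structure on T,
    so that closure lemmas for measurable sets and functions apply. *)
Lemma measurable_sigma_of_processP d (T : measurableType d) (I E : Type) (D : set I)
    (X : I -> T -> E) :
  let T' := g_sigma_algebraType (\bigcup_(t in D) sigma_of (X t)) in
  forall A : set T, sigma_of_process D X A <-> measurable (A : set T').
Proof. by []. Qed.

Lemma measurable_fun_process d (T : measurableType d) (I : Type) (D : set I)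
    (X : I -> T -> nat) (t : I) : D t ->
  measurable_fun setT
    (X t : g_sigma_algebraType (\bigcup_(t in D) sigma_of (X t)) -> nat).
Proof.
move=> Dt _ A _; rewrite setTI; apply/measurable_sigma_of_processP.
by apply: (sigma_of_in_process (X := X) Dt); exists A => //; rewrite setTI.
Qed.

End measurable_nat_functions.

(** * Joint law of the cell increments and the rolls *)

Section cell_probabilities.
Context d (T : measurableType d) (R : realType) (P : probability T R).

Lemma independent_family_seq (I : choiceType) (F : I -> set (set T)) (s : seq I)
    (A : I -> set T) : independent_family P F -> uniq s ->
  (forall i, i \in s -> F i (A i)) ->
  P (\bigcap_(i in [set` s]) A i) = (\prod_(i <- s) P (A i))%E.
Proof.
move=> indF us FA.
have := indF [fset x in s]%fset A.
rewrite (perm_big s) /=; last first.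
  by apply: uniq_perm => // i; rewrite !inE.
rewrite (_ : [set` [fset x in s]%fset] = [set` s]); last first.
  by apply/seteqP; split=> i /=; rewrite !inE.
by apply => i; rewrite !inE; exact: FA.
Qed.

Variables (q : nat) (i0 : 'I_q) (p : 'I_q -> R) (M : R -> T -> nat) (xi : nat -> T -> 'I_q).
Hypothesis cM : counting_process M.
Hypothesis iM : independent_increments P M.
Hypothesis sM : stationary_increments P M.
Hypothesis hxi : die_rolls P p M xi.

Variable n : nat.
Definition mesh_time (c : nat) : R := c%:R / n.+1%:R.
Definition cell_increment (c : nat) : T -> nat :=
  increment M (mesh_time c) (mesh_time c.+1).

Lemma mesh_time_ge0 c : 0 <= mesh_time c.
Proof. by rewrite divr_ge0. Qed.

Lemma mesh_time_lt c : mesh_time c < mesh_time c.+1.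
Proof. by rewrite ltr_pM2r ?invr_gt0// ltr_nat. Qed.

Lemma measurable_increment s t : 0 <= s -> 0 <= t -> measurable_fun setT (increment M s t).
Proof.
by case: cM => mM _ _ s0 t0; apply: (measurable_nat2 (fun a b => a - b)%N); exact: mM.
Qed.

Lemma measurable_cell_increment c : measurable_fun setT (cell_increment c).
Proof. by apply: measurable_increment; exact: mesh_time_ge0. Qed.

Lemma cell_increment_law c (A : set nat) :
  P (cell_increment c @^-1` A) = P (cell_increment 0 @^-1` A).
Proof.
have := @sM 0 n.+1%:R^-1 (mesh_time c) (lexx 0) _ (mesh_time_ge0 c) A.
rewrite invr_ge0 => /(_ (ler0n _ _)).
rewrite add0r (_ : n.+1%:R^-1 + mesh_time c = mesh_time c.+1); last first.
  by rewrite /mesh_time -[c.+1%:R]natr1 mulrDl mul1r addrC.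
rewrite /cell_increment => ->.
by rewrite /mesh_time mul0r mul1r.
Qed.

Lemma sigma_increments (ds : seq nat) :
  sigma_of_process [set t : R | 0 <= t] M
    [set w | mkseq (cell_increment ^~ w) (size ds) = ds].
Proof.
apply/measurable_sigma_of_processP.
rewrite (_ : [set w | _] = \bigcap_(c in `I_(size ds))
    (cell_increment c @^-1` [set nth 0%N ds c])).
  apply: fin_bigcap_measurable; first exact: finite_II.
  move=> c _; apply: measurable_nat_preimage.
  apply: (measurable_nat2 (fun a b => a - b)%N);
    apply: measurable_fun_process; exact: mesh_time_ge0.
apply/seteqP; split=> w /=.
  by move=> E c /= cds; rewrite -[in RHS]E nth_mkseq.
move=> H; apply: (@eq_from_nth _ 0%N); rewrite size_mkseq// => c cds.
by rewrite nth_mkseq//; exact: H.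
Qed.

Lemma sigma_rolls (es : seq 'I_q) :
  sigma_of_process [set: nat] xi [set w | mkseq (xi ^~ w) (size es) = es].
Proof.
apply/measurable_sigma_of_processP.
rewrite (_ : [set w | _] = \bigcap_(m in `I_(size es)) (xi m @^-1` [set nth i0 es m])).
  apply: fin_bigcap_measurable; first exact: finite_II.
  move=> m _; apply/measurable_sigma_of_processP.
  apply: (sigma_of_in_process (X := xi) (t := m)) => //.
  by exists [set nth i0 es m] => //; rewrite setTI.
apply/seteqP; split=> w /=.
  by move=> E c /= cds; rewrite -[in RHS]E nth_mkseq.
move=> H; apply: (@eq_from_nth _ i0); rewrite size_mkseq// => c cds.
by rewrite nth_mkseq//; exact: H.
Qed.

Lemma prob_increments (ds : seq nat) :
  P [set w | mkseq (cell_increment ^~ w) (size ds) = ds] =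
  (\prod_(m <- ds) P (cell_increment 0 @^-1` [set m]))%E.
Proof.
rewrite (_ : [set w | _] = \bigcap_(c in [set` enum 'I_(size ds)])
    (cell_increment (val c) @^-1` [set nth 0%N ds c])); last first.
  apply/seteqP; split=> w /=.
    by move=> E c _; have /= := congr1 (fun s => nth 0%N s c) E; rewrite nth_mkseq.
  move=> H; apply: (@eq_from_nth _ 0%N); rewrite size_mkseq// => c cds.
  by rewrite nth_mkseq//; apply: (H (Ordinal cds)); rewrite /= mem_enum.
rewrite (@independent_family_seq _ (fun c : 'I_(size ds) =>
  sigma_of (increment M (mesh_time c) (mesh_time c.+1)))); last 3 first.
- apply: iM; first exact: mesh_time_ge0.
  by move=> i _; exact: mesh_time_lt.
- exact: enum_uniq.
- by move=> c _; exists [set nth 0%N ds c] => //; rewrite setTI.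
rewrite big_enum /= (big_nth 0%N) big_mkord.
by apply: eq_bigr => c _; rewrite cell_increment_law.
Qed.

Lemma prob_rolls (es : seq 'I_q) :
  P [set w | mkseq (xi ^~ w) (size es) = es] = (\prod_(i <- es) (p i)%:E)%E.
Proof.
case: hxi => _ pxi ixi _.
rewrite (_ : [set w | _] = \bigcap_(m in [set` iota 0 (size es)])
    (xi m @^-1` [set nth i0 es m])); last first.
  apply/seteqP; split=> w /=.
    by move=> E c /=; rewrite mem_iota => /andP[_ cs]; rewrite -[in RHS]E nth_mkseq.
  move=> H; apply: (@eq_from_nth _ i0); rewrite size_mkseq// => c cds.
  by rewrite nth_mkseq//; apply: (H c); rewrite /= mem_iota.
rewrite (@independent_family_seq _ _ _ _ ixi) ?iota_uniq//; last first.
  by move=> m _; exists [set nth i0 es m] => //; rewrite setTI.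
rewrite [RHS](big_nth i0) /index_iota subn0.
by apply: eq_bigr => c _; rewrite pxi.
Qed.

(** This is the hypothesis [cell_eventE]: M and the rolls separate first, then each family
    factorises, and stationarity brings every cell back to cell 0. *)
Lemma cell_event_prob ds es : Ex P (\1_(cell_event cell_increment xi ds es)) =
  \prod_(m <- ds) Ex P (\1_(cell_increment 0 @^-1` [set m])) * \prod_(i <- es) p i.
Proof.
case: hxi => mxi _ _ indp.
apply: EFin_inj; rewrite -Ex_indicE; last first.
  apply: measurable_cell_event => //; exact: measurable_cell_increment.
rewrite EFinM -!prodEFin.
have E : cell_event cell_increment xi ds es =
    [set w | mkseq (xi ^~ w) (size es) = es] `&`
    [set w | mkseq (cell_increment ^~ w) (size ds) = ds].
  by apply/seteqP; split=> w [].
rewrite E indp; [|exact: sigma_rolls|exact: sigma_increments].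
rewrite prob_rolls prob_increments muleC; congr (_ * _)%E.
apply: eq_bigr => m _; rewrite -Ex_indicE//.
by apply: measurable_nat_preimage; exact: measurable_cell_increment.
Qed.

End cell_probabilities.

(** * Cell weights along a fixed path *)

Section path_blocks.
Context (R : realType) (x : R -> nat).
Hypothesis x_mono : forall s t : R, 0 <= s -> s <= t -> (x s <= x t)%N.
Hypothesis x_rc : forall t : R, 0 <= t -> x u @[u --> t^'+] --> x t.
Hypothesis x0 : x 0 = 0%N.
Variables (q : nat) (c : nat -> 'I_q).

Let y (i : 'I_q) (t : R) := split_path x c i t.
Let J n m := jump_count x (mesh_time R n m).
Let dd n m := (x (mesh_time R n m.+1) - x (mesh_time R n m))%N.

(** Jump sizes are positive, so the increment vanishes exactly when the cell has no jump. Otherwise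
    its only jump has number J n m, counted from 0, and the whole increment goes to face c (J n
    m). *)
Lemma cell_weight_step n (s : 'I_q -> R) m cs : (J n m.+1 <= (J n m).+1)%N ->
  cell_weight (dd n) c m (J n m) (s :: cs) =
  \prod_i s i ^+ (y i (mesh_time R n m.+1) - y i (mesh_time R n m)) *
  cell_weight (dd n) c m.+1 (J n m.+1) cs.
Proof.
move=> Jm /=; have m0 := mesh_time_ge0 R n m.
have mm := ltW (mesh_time_lt R n m).
case: eqP => E.
  have Ex : x (mesh_time R n m) = x (mesh_time R n m.+1).
    by apply/eqP; rewrite eqn_leq x_mono//=; move/eqP: E; rewrite /dd subn_eq0.
  have -> : J n m.+1 = J n m by rewrite /J (@jump_count_eq _ x _ _ _ _ _ m0 mm Ex).
  rewrite big1 ?mul1r// => i _.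
  by rewrite /y (split_path_eq x_mono x_rc x0 c i m0 mm Ex) subnn expr0.
have EJ : J n m.+1 = (J n m).+1.
  apply/eqP; rewrite eqn_leq Jm /= ltn_neqAle jump_count_mono// andbT.
  apply/eqP => H; apply: E; rewrite /dd.
  rewrite (path_sum_jumps x_mono x_rc x0 m0).
  by rewrite (path_sum_jumps x_mono x_rc x0 (le_trans m0 mm)) -/(J n m) -/(J n m.+1) H subnn.
rewrite EJ; congr (_ * _).
rewrite (bigD1 (c (J n m)))//= big1 ?mulr1; last first.
  move=> i ic; rewrite /y (split_path_single_jump x_mono x_rc x0 c i m0 mm EJ).
  by rewrite -/(J n m) eq_sym (negPf ic) muln0 addn0 subnn.
rewrite /y (split_path_single_jump x_mono x_rc x0 c _ m0 mm EJ).
by rewrite -/(J n m) eqxx muln1 addKn.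
Qed.

Lemma cell_weight_block n (s : 'I_q -> R) a l cs :
  (forall m, (m < a + l)%N -> (J n m.+1 <= (J n m).+1)%N) ->
  cell_weight (dd n) c a (J n a) (nseq l s ++ cs) =
  \prod_i s i ^+ (y i (mesh_time R n (a + l)) - y i (mesh_time R n a)) *
  cell_weight (dd n) c (a + l) (J n (a + l)) cs.
Proof.
elim: l a => [|l IH] a H.
  by rewrite addn0 big1 ?mul1r// => i _; rewrite subnn expr0.
have aal : (a < a + l.+1)%N by rewrite addnS ltnS leq_addr.
rewrite cell_weight_step; last exact: H.
rewrite IH; last by rewrite addSnnS.
rewrite mulrA addSnnS -big_split /=; congr (_ * _); apply: eq_bigr => i _.
rewrite -exprD; congr (_ ^+ _).
have mt a' b' : (a' <= b')%N -> mesh_time R n a' <= mesh_time R n b'.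
  by move=> ab; rewrite ler_pM2r ?invr_gt0// ler_nat.
have h1 : (y i (mesh_time R n a) <= y i (mesh_time R n a.+1))%N.
  by apply: split_path_mono => //; apply: mt.
have h2 : (y i (mesh_time R n a.+1) <= y i (mesh_time R n (a + l.+1)))%N.
  by apply: split_path_mono => //; apply: mt.
lia.
Qed.

(** The weight s l is repeated on every cell between the rounded times t l and t l.+1. *)
Fixpoint blocks (n : nat) (t : nat -> R) (s : nat -> 'I_q -> R) (L : nat) : seq ('I_q -> R) :=
  if L is L'.+1 then
    nseq (grid n (t 1%N) - grid n (t 0%N)) (s 0%N) ++ blocks n (t \o S) (s \o S) L'
  else [::].

Lemma chain_le (t : nat -> R) L : (forall l, (l < L)%N -> t l <= t l.+1) ->
  forall l l', (l <= l')%N -> (l' <= L)%N -> t l <= t l'.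
Proof.
move=> H l; elim=> [|l' IH]; first by rewrite leqn0 => /eqP->.
rewrite leq_eqVlt => /orP[/eqP->//|ll'] l'L.
by apply: le_trans (H _ l'L); apply: IH => //; exact: ltnW.
Qed.

Lemma cell_weight_blocks n L (t : nat -> R) (s : nat -> 'I_q -> R) :
  0 <= t 0%N -> (forall l, (l < L)%N -> t l <= t l.+1) ->
  (forall m, (m < grid n (t L))%N -> (J n m.+1 <= (J n m).+1)%N) ->
  cell_weight (dd n) c (grid n (t 0%N)) (J n (grid n (t 0%N))) (blocks n t s L) =
  \prod_(l < L) \prod_i s l i ^+
    (y i (mesh_time R n (grid n (t l.+1))) - y i (mesh_time R n (grid n (t l)))).
Proof.
elim: L t s => [|L IH] t s t0 H HJ; first by rewrite big_ord0.
have t01 : t 0%N <= t 1%N by exact: H.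
have g01 : (grid n (t 0%N) + (grid n (t 1%N) - grid n (t 0%N)) = grid n (t 1%N))%N.
  by rewrite subnKC// grid_mono.
rewrite [blocks _ _ _ _]/= cell_weight_block g01.
  rewrite big_ord_recl /=; congr (_ * _).
  apply: (IH (t \o S) (s \o S)) => //=; first exact: le_trans t01.
  by move=> l lL; exact: H.
move=> m mg; apply: HJ; apply: leq_trans mg _; apply: grid_mono.
  exact: le_trans t01.
exact: (chain_le H).
Qed.

Lemma near_grid_split (t : R) : 0 <= t ->
  \forall n \near \oo, forall i, y i (mesh_time R n (grid n t)) = y i t.
Proof.
move=> t0; have [e e0 He] := right_constant x_rc t0.
have := @grid_cvg R t t0 => /cvgr_lt/(_ (t + e)) H.
have {}H : \forall n \near \oo, (grid n t)%:R / n.+1%:R < t + e by apply: H; rewrite ltrDl.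
apply: filterS H => n Hn i; apply/esym/split_path_eq => //.
  exact/ltW/grid_gt.
by rewrite He// ltW// grid_gt.
Qed.

Lemma near_grid_splits (t : nat -> R) L : (forall l, (l <= L)%N -> 0 <= t l) ->
  \forall n \near \oo, forall l i, (l <= L)%N ->
    y i (mesh_time R n (grid n (t l))) = y i (t l).
Proof.
elim: L => [|L IH] H.
  have := near_grid_split (H 0%N (leqnn _)); apply: filterS => n Hn l i.
  by rewrite leqn0 => /eqP->.
have H1 : \forall n \near \oo, forall l i, (l <= L)%N ->
    y i (mesh_time R n (grid n (t l))) = y i (t l).
  by apply: IH => l lL; apply: H; exact: leqW.
have H2 := near_grid_split (H L.+1 (leqnn _)).
near=> n => l i; rewrite leq_eqVlt => /orP[/eqP->|].
  by move: i; near: n.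
by rewrite ltnS; move: l i; near: n.
Unshelve. all: by end_near. Qed.

Lemma near_single_jumps (b : R) : 0 <= b ->
  \forall n \near \oo, forall m, (m < grid n b)%N -> (J n m.+1 <= (J n m).+1)%N.
Proof.
(* Rounding b upwards overshoots by at most one cell, whose length is at most 1. *)
move=> b0; have [e e0 He] := jump_count_mesh x_mono x_rc x0 (b + 1).
have : \forall n \near \oo, n.+1%:R^-1 < e.
  by have /cvgr_lt := @cvg_harmonic R; apply.
apply: filterS => n ne m mg; apply: He.
- exact: mesh_time_ge0.
- exact/ltW/mesh_time_lt.
- apply: le_trans (_ : mesh_time R n (grid n b) <= _).
    by rewrite ler_pM2r ?invr_gt0// ler_nat.
  apply: le_trans (grid_le n b0) _; rewrite lerD2l invf_le1//.
  by rewrite ler1n.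
- rewrite /mesh_time -mulrBl -natrB// subSnn mul1r//.
Qed.

(** The leading weights 1 cover the time before t 0: they contribute the factor 1 but advance the
    roll counter to the number of jumps already made. *)
Lemma near_cell_weight (t : nat -> R) (s : nat -> 'I_q -> R) L :
  0 <= t 0%N -> (forall l, (l < L)%N -> t l <= t l.+1) ->
  \forall n \near \oo,
  cell_weight (dd n) c 0 0 (nseq (grid n (t 0%N)) (fun=> 1) ++ blocks n t s L) =
  \prod_(l < L) \prod_i s l i ^+ (y i (t l.+1) - y i (t l)).
Proof.
move=> t0 H; have tl l : (l <= L)%N -> 0 <= t l.
  by move=> lL; apply: le_trans t0 _; exact: (chain_le H).
have H1 := near_grid_splits tl.
have H2 := near_single_jumps (tl L (leqnn _)).
near=> n.
have H2n : forall m, (m < grid n (t L))%N -> (J n m.+1 <= (J n m).+1)%N by near: n.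
have H1n : forall l i, (l <= L)%N -> y i (mesh_time R n (grid n (t l))) = y i (t l) by near: n.
have J0 : J n 0 = 0%N by rewrite /J /mesh_time mul0r jump_count0.
rewrite -[X in cell_weight _ _ _ X]J0 cell_weight_block add0n; last first.
  move=> m mg; apply: H2n; apply: leq_trans mg _; apply: grid_mono => //.
  exact: (chain_le H).
rewrite big1 ?mul1r; last by move=> i _; rewrite expr1n.
rewrite cell_weight_blocks//; apply: eq_bigr => l _; apply: eq_bigr => i _.
by rewrite !H1n// ltnW.
Unshelve. all: by end_near. Qed.

End path_blocks.

Lemma nseq_weights01 (R : realType) q m (s : 'I_q -> R) cs :
  (forall i, 0 <= s i <= 1) ->
  List.Forall (fun s : 'I_q -> R => forall i, 0 <= s i <= 1) cs ->
  List.Forall (fun s : 'I_q -> R => forall i, 0 <= s i <= 1) (nseq m s ++ cs).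
Proof. by move=> Hs Hcs; elim: m => [|m IH] //=; constructor. Qed.

Lemma blocks_weights01 (R : realType) q n L (t : nat -> R) (s : nat -> 'I_q -> R) :
  (forall l i, 0 <= s l i <= 1) ->
  List.Forall (fun s : 'I_q -> R => forall i, 0 <= s i <= 1) (blocks n t s L).
Proof.
elim: L t s => [|L IH] t s H /=; first exact: List.Forall_nil.
apply: nseq_weights01 => [i|]; first exact: H.
by apply: IH => l i; exact: H.
Qed.

Lemma prod_nseq_cat (R : realType) (I : Type) m (s : I) cs (F : I -> R) :
  \prod_(u <- nseq m s ++ cs) F u = F s ^+ m * \prod_(u <- cs) F u.
Proof. by rewrite big_cat /= big_nseq iter_mulr_1. Qed.

Lemma prod_blocks (R : realType) q n L (t : nat -> R) (s : nat -> 'I_q -> R)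
    (F : ('I_q -> R) -> R) :
  \prod_(u <- blocks n t s L) F u =
  \prod_(l < L) F (s l) ^+ (grid n (t l.+1) - grid n (t l)).
Proof.
elim: L t s => [|L IH] t s /=; first by rewrite big_nil big_ord0.
by rewrite prod_nseq_cat big_ord_recl IH.
Qed.

Lemma cell_weight01 (R : realType) q (dd : nat -> nat) (e : nat -> 'I_q) c n
    (cs : seq ('I_q -> R)) :
  List.Forall (fun s : 'I_q -> R => forall i, 0 <= s i <= 1) cs ->
  0 <= cell_weight dd e c n cs <= 1.
Proof.
elim: cs c n => [|s cs IH] c n Hs /=; first by rewrite ler01 lexx.
have Hs0 : forall i, 0 <= s i <= 1 by inversion Hs.
have Hs' : List.Forall (fun s : 'I_q -> R => forall i, 0 <= s i <= 1) cs by inversion Hs.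
case: ifP => _; first exact: IH.
have /andP[h1 h2] := IH c.+1 n.+1 Hs'; have /andP[h3 h4] := Hs0 (e n).
by rewrite mulr_ge0 ?exprn_ge0//= mulr_ile1 ?exprn_ge0 ?exprn_ile1.
Qed.

(** * Joint generating function of the split increments *)

Section split_generating_function.
Context d (T : measurableType d) (R : realType) (P : probability T R).
Context (k : nat) (lam : 'I_k -> R) (M : R -> T -> nat).
Hypothesis hM : gcp P lam M.

Let prob (Y : T -> nat) n := Ex P (\1_(Y @^-1` [set n])).

(** State 0 is certain at time 0, so conditioning on it changes nothing and the transition estimates
    become estimates on the law of M h. *)
Lemma gcp_transition0 (j : nat) (h : R) : 0 <= h ->
  transition_prob P M 0 0 j h = prob (M h) j.
Proof.
case: hM => _ [mM _ _] M0 _ _ h0.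
rewrite /transition_prob /cond_prob add0r add0n.
have -> : M 0 @^-1` [set 0%N] = setT by apply/seteqP; split=> // w _ /=; exact: M0.
rewrite setIT [X in _ / fine X](probability_setT P) invr1 mulr1 /prob Ex_indic//.
by apply: measurable_nat_preimage; exact: mM.
Qed.

Lemma gcp_rates :
  (1 - prob (M h) 0) / h @[h --> 0^'+] --> \sum_j lam j /\
  forall j : 'I_k, prob (M h) j.+1 / h @[h --> 0^'+] --> lam j.
Proof.
case: (hM) => _ [mM _ _] M0 _ Htr.
have P0 : (0 < P (M 0%R @^-1` [set 0%N]))%E.
  have -> : M 0 @^-1` [set 0%N] = setT by apply/seteqP; split=> // w _ /=; exact: M0.
  by rewrite [X in (_ < X)%E](probability_setT P).
have [H0 Hj _] := Htr 0 0%N (lexx 0) P0.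
split=> [|j].
  move/littleo_id_cvg : H0 => H0.
  have H1 : (\sum_j lam j -
      (transition_prob P M 0 0 0 h - (1 - \sum_(j < k) lam j * h)) / h) @[h --> 0^'+]
      --> \sum_j lam j.
    by rewrite -[X in _ --> X]subr0; apply: cvgB => //; exact: cvg_cst.
  apply: cvg_trans H1; apply: near_eq_cvg; near=> h.
  have h0 : 0 < h by near: h; exact: nbhs_right_gt.
  rewrite gcp_transition0 ?ltW// -mulr_suml; field; exact: lt0r_neq0.
have /littleo_id_cvg Hj' := Hj j.
have H1 : (lam j + (transition_prob P M 0 0 j.+1 h - lam j * h) / h) @[h --> 0^'+] --> lam j.
  by rewrite -[X in _ --> X]addr0; apply: cvgD => //; exact: cvg_cst.
apply: cvg_trans H1; apply: near_eq_cvg; near=> h.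
have h0 : 0 < h by near: h; exact: nbhs_right_gt.
rewrite gcp_transition0 ?ltW//; field; exact: lt0r_neq0.
Unshelve. all: by end_near. Qed.

Context (q : nat) (hq : (2 <= q)%N) (p : 'I_q -> R).
Hypothesis hp : forall i, 0 < p i.
Hypothesis hp1 : \sum_(i < q) p i = 1.
Context (xi : nat -> T -> 'I_q).
Hypothesis hxi : die_rolls P p M xi.

Let G n (s : R) := Ex P (fun w => s ^+ cell_increment M n 0 w).
Let S n (s : 'I_q -> R) := \sum_i p i * G n (s i).

Let cM : counting_process M. Proof. by case: hM. Qed.
Let iM : independent_increments P M. Proof. by case: hM => _ _ _ []. Qed.
Let sM : stationary_increments P M. Proof. by case: hM => _ _ _ []. Qed.

Lemma cell_gf01 n s : 0 <= s <= 1 -> 0 <= G n s <= 1.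
Proof.
move=> s01; have bs := bounded_rv_pow (measurable_cell_increment cM n 0) s01.
have /andP[s0 s1] := s01.
rewrite -[X in X <= _](Ex_cst P) -[X in _ <= _ <= X](Ex_cst P).
apply/andP; split; apply: le_Ex => //; try exact: bounded_rv_cst.
  by move=> w; rewrite exprn_ge0.
by move=> w; rewrite exprn_ile1.
Qed.

Lemma cell_gf_cvg s : 0 <= s <= 1 ->
  n.+1%:R * (1 - G n s) @[n --> \oo] --> cumulant lam s.
Proof.
move=> s01; case: (hM) => _ [mM _ _] M0 _ _.
have [H0 Hj] := gcp_rates.
have H := gf_rate mM s01 H0 Hj.
have hn : (n.+1%:R^-1 : R) @[n --> \oo] --> 0^'+.
  move=> A [e /= e0 HA].
  have : \forall n \near \oo, n.+1%:R^-1 < e by have /cvgr_lt := @cvg_harmonic R; apply.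
  apply: filterS => n ne; apply: HA => /=; last by rewrite invr_gt0.
  by rewrite sub0r normrN gtr0_norm ?invr_gt0.
have := cvg_comp _ _ hn H; apply: cvg_trans; apply: near_eq_cvg; apply: nearW => n /=.
rewrite invrK mulrC; congr (_ * (1 - _)); apply: eq_Ex => w.
by rewrite /cell_increment /increment /mesh_time mul0r mul1r M0 subn0.
Qed.

(** The mixture over faces becomes a sum of exponents, one per face; this is the source of the
    independence of the components and of the rates lam j * p i. *)
Lemma face_cumulant (s : 'I_q -> R) :
  \sum_i p i * cumulant lam (s i) = \sum_i cumulant (fun j => lam j * p i) (s i).
Proof.
apply: eq_bigr => i _; rewrite mulr_sumr; apply: eq_bigr => j _.
by rewrite mulrA [p i * _]mulrC.
Qed.

Theorem split_gf (t : nat -> R) (s : nat -> 'I_q -> R) L :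
  0 <= t 0%N -> (forall l, (l < L)%N -> t l <= t l.+1) ->
  (forall l i, 0 <= s l i <= 1) ->
  let F w := \prod_(l < L) \prod_i
    s l i ^+ increment (typeI_split M xi i) (t l) (t l.+1) w in
  bounded_rv F /\
  Ex P F = \prod_(l < L) \prod_i
    expR (- ((t l.+1 - t l) * cumulant (fun j => lam j * p i) (s l i))).
Proof.
move=> t0 Ht s01 F.
case: (hM) => _ [mM monoM rcM] M0 _ _; have [mxi _ _ _] := hxi.
have i0 : 'I_q := Ordinal (ltnW hq).
have tl l : (l <= L)%N -> 0 <= t l.
  by move=> lL; apply: le_trans t0 _; exact: (chain_le Ht).
pose cs n := nseq (grid n (t 0%N)) (fun=> 1) ++ blocks n t s L.
have cs01 n : List.Forall (fun s : 'I_q -> R => forall i, 0 <= s i <= 1) (cs n).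
  by apply: nseq_weights01 => [i|]; [rewrite ler01 lexx | exact: blocks_weights01].
pose Z n w := cell_weight (cell_increment M n ^~ w) (xi ^~ w) 0 0 (cs n).
have bZ n : bounded_rv (Z n).
  exact: (bounded_cell_weight (measurable_cell_increment cM n) mxi).
have Z01 n w : `|Z n w| <= 1.
  by have /andP[h0 h1] := cell_weight01 (cell_increment M n ^~ w) (xi ^~ w) 0 0 (cs01 n);
    rewrite ger0_norm.
have cZ w : Z n w @[n --> \oo] --> F w.
  apply: cvg_near_cst.
  exact: (near_cell_weight (x := M ^~ w) (monoM w) (rcM w) (M0 w) (xi ^~ w) s t0 Ht).
have [bF cF] := bounded_cvg_Ex P bZ Z01 cZ; split=> //.
rewrite -(cvg_lim (@norm_hausdorff _ _) cF); apply: cvg_lim => //.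
(* The initial cells of weight 1 contribute powers of the total face probability, which is 1. *)
have EZ n : Ex P (Z n) = \prod_(l < L) S n (s l) ^+ (grid n (t l.+1) - grid n (t l)).
  rewrite (Ex_cell_weight0 (measurable_cell_increment cM n) mxi hp1
    (cell_event_prob i0 cM iM sM hxi n) (cs01 n)).
  rewrite /cs prod_nseq_cat prod_blocks (_ : \sum_i _ = 1).
    by rewrite expr1n mul1r.
  rewrite -[RHS]hp1; apply: eq_bigr => i _.
  by under eq_Ex do rewrite expr1n; rewrite Ex_cst mulr1.
under eq_cvg do rewrite EZ.
apply: cvg_prod_seq => l.
have lL := ltn_ord l.
rewrite -expR_sum sumrN -mulr_sumr -face_cumulant.
apply: pow_cvg_exp.
- move=> n; apply/andP; split.
    apply: sumr_ge0 => i _; have /andP[g0 _] := cell_gf01 n (s01 l i).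
    by rewrite mulr_ge0// ltW.
  rewrite -hp1; apply: ler_sum => i _; have /andP[_ g1] := cell_gf01 n (s01 l i).
  by rewrite -[leRHS]mulr1 ler_wpM2l// ltW.
- rewrite (_ : (fun n => _) = fun n => \sum_i p i * (n.+1%:R * (1 - G n (s l i)))).
    by apply: cvg_sum_seq => i; apply: cvgM; [exact: cvg_cst|exact: cell_gf_cvg].
  apply/funext => n; rewrite -[X in X - _]hp1 -sumrB mulr_sumr; apply: eq_bigr => i _.
  by ring.
- by apply: grid_diff_cvg; [apply: tl; exact: ltnW | exact: Ht].
Qed.

End split_generating_function.

(** * Laws and sigma-algebras recovered from powers *)

Section laws.
Context d (T : measurableType d) (R : realType) (P : probability T R).

(** The powers of 1/2 are distinct, so each level set of Y is a level set of the real function. *)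
Lemma measurable_of_pow (Y : T -> nat) :
  measurable_fun setT (fun w => (2^-1 : R) ^+ Y w) -> measurable_fun setT Y.
Proof.
move=> m2 _ A _; rewrite setTI.
rewrite (_ : Y @^-1` A = \bigcup_(n in A) (Y @^-1` [set n])); last first.
  by apply/seteqP; split=> [w Aw|w [n An /= ->]//]; exists (Y w).
apply: bigcup_measurable => n _.
have := m2 measurableT [set (2^-1 : R) ^+ n] (measurable_set1 _).
rewrite setTI; congr measurable; apply/seteqP; split=> w /=; last by move=> ->.
move=> E; apply/eqP; move/eqP: E; rewrite !exprVn (inj_eq invr_inj).
by rewrite -!natrX eqr_nat eqn_exp2l.
Qed.

Lemma gf_law (Y Y' : T -> nat) : measurable_fun setT Y -> measurable_fun setT Y' ->
  (forall s : R, 0 <= s <= 1 -> Ex P (fun w => s ^+ Y w) = Ex P (fun w => s ^+ Y' w)) ->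
  forall A, P (Y @^-1` A) = P (Y' @^-1` A).
Proof.
move=> mY mY' H A.
have b1 : bounded_rv (fun=> 1 : R) := @bounded_rv_cst _ T R 1.
have Hn n : Ex P (\1_(Y @^-1` [set n])) = Ex P (\1_(Y' @^-1` [set n])).
  apply/eqP; rewrite -subr_eq0; apply/eqP.
  have := coef_unique (expandsB (gf_expands P mY b1) (gf_expands P mY' b1)) _ n.
  under eq_Ex do rewrite mul1r; under [X in _ - X]eq_Ex do rewrite mul1r.
  apply=> s /andP[s0 s1]; apply/eqP; rewrite subr_eq0; apply/eqP.
  under eq_Ex do rewrite mul1r; under [in RHS]eq_Ex do rewrite mul1r.
  by apply: H; rewrite ltW.
have mA (Z : T -> nat) : measurable_fun setT Z -> measurable (Z @^-1` A).
  by move=> mZ; exact: measurable_nat_preimage.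
have part (Z : T -> nat) : measurable_fun setT Z ->
    (\sum_(n < m) (val n \in A)%:R * Ex P (\1_(Z @^-1` [set val n]))) @[m --> \oo]
    --> Ex P (\1_(Z @^-1` A)).
  move=> mZ; have := Ex_partition (P := P) mZ (bounded_rv_indic R (mA Z mZ)); apply: cvg_trans.
  apply: near_eq_cvg; apply: nearW => m; apply: eq_bigr => n _.
  rewrite -ExZ; last by apply: bounded_rv_indic; exact: measurable_nat_preimage.
  apply: eq_Ex => w; rewrite !indicE -!natrM; congr (_%:R).
  have [/set_mem /= <-|_] := boolP (w \in Z @^-1` [set val n]); last by rewrite !muln0.
  by rewrite !muln1; congr nat_of_bool.
rewrite !Ex_indicE; [|exact: mA..].
congr EFin; rewrite -(cvg_lim (@norm_hausdorff _ _) (part Y mY)).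
rewrite -(cvg_lim (@norm_hausdorff _ _) (part Y' mY')).
by under eq_fun do under eq_bigr do rewrite Hn.
Qed.

Lemma prod_uniq_if (I : finType) (r : seq I) (F : I -> R) : uniq r ->
  \prod_(i <- r) F i = \prod_i (if i \in r then F i else 1).
Proof. by move=> ur; rewrite big_uniq// big_mkcond. Qed.

Definition powers (Y : T -> nat) : set (T -> R) :=
  [set f | exists2 s : R, 0 <= s <= 1 & f = fun w => s ^+ Y w].

(** Y is viewed as a process with one time; a power product is then a single power, whose base is
    the product of the bases. *)
Lemma powers_determine (Y : T -> nat) : measurable_fun setT Y ->
  determines P (powers Y) (sigma_of Y).
Proof.
move=> mY A AY.
have pY : sigma_of_process [set: unit] (fun=> Y) A.
  exact: (sigma_of_in_process (X := fun _ : unit => Y) (t := tt)).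
have [mA H] := power_products_determine P (D := [set: unit]) (X := fun=> Y) (fun _ _ => mY) pY.
split=> // W bW HW; apply: H => // f [l [Hl ->]].
apply: HW; exists (\prod_(p <- l) p.2).
  elim: l Hl => [|p l IH] Hl; first by rewrite big_nil ler01 lexx.
  have [_ /andP[p0 p1]] := Hl p (mem_head _ _).
  have /andP[l0 l1] : 0 <= \prod_(p <- l) p.2 <= 1.
    by apply: IH => p' p'l; apply: Hl; rewrite inE p'l orbT.
  by rewrite big_cons mulr_ge0//= mulr_ile1.
by apply/funext => w; rewrite prodrXl.
Qed.

End laws.

(** * Independence and rates of the components *)

Section split_components.
Context d (T : measurableType d) (R : realType) (P : probability T R).
Context (k : nat) (lam : 'I_k -> R) (M : R -> T -> nat).
Hypothesis hM : gcp P lam M.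
Context (q : nat) (hq : (2 <= q)%N) (p : 'I_q -> R).
Hypothesis hp : forall i, 0 < p i.
Hypothesis hp1 : \sum_(i < q) p i = 1.
Context (xi : nat -> T -> 'I_q).
Hypothesis hxi : die_rolls P p M xi.

Let N (i : 'I_q) : R -> T -> nat := typeI_split M xi i.
Let mu (i : 'I_q) (j : 'I_k) := lam j * p i.

Lemma cumulant1 (nu : 'I_k -> R) : cumulant nu 1 = 0.
Proof. by rewrite /cumulant big1// => j _; rewrite expr1n subrr mulr0. Qed.

(** Setting the variables of the other faces to 1 erases them on both sides, since the cumulant
    vanishes at 1. *)
Lemma face_gf (i : 'I_q) (t : nat -> R) (s : nat -> R) L :
  0 <= t 0%N -> (forall l, (l < L)%N -> t l <= t l.+1) -> (forall l, 0 <= s l <= 1) ->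
  let F w := \prod_(l < L) s l ^+ increment (N i) (t l) (t l.+1) w in
  bounded_rv F /\
  Ex P F = \prod_(l < L) expR (- ((t l.+1 - t l) * cumulant (mu i) (s l))).
Proof.
move=> t0 Ht s01 F.
pose s' l (i' : 'I_q) := if i' == i then s l else 1.
have s'01 l i' : 0 <= s' l i' <= 1 by rewrite /s'; case: ifP => // _; rewrite ler01 lexx.
have := split_gf hM hq hp hp1 hxi t0 Ht s'01.
rewrite (_ : (fun w => _) = F); last first.
  apply/funext => w; apply: eq_bigr => l _; rewrite (bigD1 i)//= big1 ?mulr1.
    by rewrite /s' eqxx.
  by move=> i' /negPf ii; rewrite /s' ii expr1n.
move=> [bF ->]; split=> //; apply: eq_bigr => l _.
rewrite (bigD1 i)//= big1 ?mulr1; first by rewrite /s' eqxx.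
by move=> i' /negPf ii; rewrite /s' ii cumulant1 mulr0 oppr0 expR0.
Qed.

Lemma increment_gf (i : 'I_q) (a b s : R) : 0 <= a -> a <= b -> 0 <= s <= 1 ->
  bounded_rv (fun w => s ^+ increment (N i) a b w) /\
  Ex P (fun w => s ^+ increment (N i) a b w) = expR (- ((b - a) * cumulant (mu i) s)).
Proof.
move=> a0 ab s01.
have := @face_gf i (fun l => if l == 0%N then a else b) (fun=> s) 1 a0 _ (fun=> s01).
rewrite big_ord_recl big_ord0 mulr1 /=.
rewrite (_ : (fun w => \prod_(l < 1) _) = (fun w => s ^+ increment (N i) a b w)).
  by apply; case.
by apply/funext => w; rewrite big_ord_recl big_ord0 mulr1.
Qed.

Lemma measurable_split_increment (i : 'I_q) (a b : R) : 0 <= a -> a <= b ->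
  measurable_fun setT (increment (N i) a b).
Proof.
(* The power (1/2)^increment is a pointwise limit of measurable cell weights. *)
move=> a0 ab; apply: (@measurable_of_pow _ _ R).
have h01 : 0 <= (2^-1 : R) <= 1 by rewrite invr_ge0 ler0n invf_le1//= ler1n.
by have [[]] := increment_gf i a0 ab h01.
Qed.

Let cM : counting_process M. Proof. by case: hM. Qed.
Let M0 w : M 0 w = 0%N. Proof. by case: hM => _ _ ->. Qed.
Let M_mono w (s t : R) : 0 <= s -> s <= t -> (M s w <= M t w)%N.
Proof. by case: cM => _ + _; apply. Qed.
Let M_rc w (t : R) : 0 <= t -> M u w @[u --> t^'+] --> M t w.
Proof. by case: cM => _ _; apply. Qed.

Lemma split0 i w : N i 0 w = 0%N.
Proof. exact: (split_path0 (x := M ^~ w) (@M_mono w) (@M_rc w) (M0 w) (xi ^~ w) i). Qed.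

Lemma split_mono i w (s t : R) : s <= t -> (N i s w <= N i t w)%N.
Proof. exact: (split_path_mono (x := M ^~ w) (@M_mono w) (@M_rc w) (M0 w) (xi ^~ w) i). Qed.

Lemma split_increment0 i t : increment (N i) 0 t = N i t.
Proof. by apply/funext => w; rewrite /increment split0 subn0. Qed.

Lemma split_counting_process i : counting_process (N i).
Proof.
split=> [t t0|w s t _|w t t0]; last 1 first.
- have [e e0 He] := split_path_right_constant (x := M ^~ w)
    (@M_mono w) (@M_rc w) (M0 w) (xi ^~ w) i t0.
  apply: cvg_near_cst; near=> u; apply: He.
    by near: u; exact: nbhs_right_ge.
  by near: u; apply: nbhs_right_lt; rewrite ltrDl.
- by rewrite -split_increment0; exact: measurable_split_increment.
- exact: split_mono.
Unshelve. all: by end_near. Qed.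

Lemma split_increments_independent i n (t : nat -> R) :
  0 <= t 0%N -> (forall l, (l < n)%N -> t l <= t l.+1) ->
  independent_family P (fun l : 'I_n => sigma_of (increment (N i) (t l) (t l.+1))).
Proof.
move=> t0 Ht.
have minc (l : 'I_n) : measurable_fun setT (increment (N i) (t l) (t l.+1)).
  apply: measurable_split_increment; last exact: Ht.
  by apply: le_trans t0 _; apply: (chain_le Ht) => //; exact: ltnW.
apply: (determines_independent (K := fun l : 'I_n => powers (increment (N i) (t l) (t l.+1)))).
- by move=> l f [s s01 ->]; exact: bounded_rv_pow.
- by move=> l; exact: powers_determine.
- by move=> l; exists 1; [rewrite ler01 lexx | apply/funext => w; rewrite expr1n].
move=> r f ur Kf.
have {Kf}/choice[s Hs] : forall l : 'I_n, exists s : R, 0 <= s <= 1 /\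
    f l = fun w => s ^+ increment (N i) (t l) (t l.+1) w.
  by move=> l; have [s s01 ->] := Kf l; exists s.
pose e (l : 'I_n) := expR (- ((t l.+1 - t l) * cumulant (mu i) (s l))).
suff main (r' : seq 'I_n) : uniq r' ->
    Ex P (fun w => \prod_(l <- r') f l w) = \prod_(l <- r') e l.
  rewrite main//; apply: eq_bigr => l _; have := main [:: l] isT.
  by rewrite big_seq1 => <-; apply: eq_Ex => w; rewrite big_seq1.
move=> ur'.
(* Intervals outside r' get the variable 1, so one formula on the full grid serves every subfamily;
   [insub] extends s from ordinals to all indices. *)
pose s' (l : nat) := if insub l is Some l' then (if l' \in r' then s l' else 1) else 1.
have s'E (l : 'I_n) : s' l = if l \in r' then s l else 1 by rewrite /s' valK.
have s'01 l : 0 <= s' l <= 1.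
  rewrite /s'; case: insub => [l'|]; last by rewrite ler01 lexx.
  by case: ifP => _; [have [] := Hs l' | rewrite ler01 lexx].
have [_] := face_gf i t0 Ht s'01.
rewrite (prod_uniq_if _ ur') (_ : \prod_(l < n) expR _ = \prod_l (if l \in r' then e l else 1)).
  move=> <-; apply: eq_Ex => w; rewrite (prod_uniq_if _ ur'); apply: eq_bigr => l _.
  rewrite s'E; case: ifP => _; last by rewrite expr1n.
  by have [_ ->] := Hs l.
apply: eq_bigr => l _; rewrite s'E; case: ifP => // _.
by rewrite cumulant1 mulr0 oppr0 expR0.
Qed.

Lemma split_stationary i : stationary_increments P (N i).
Proof.
move=> s t h s0 st h0 A.
have sh0 : 0 <= s + h by rewrite addr_ge0.
have sth : s + h <= t + h by rewrite lerD2r.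
apply: gf_law; [exact: measurable_split_increment..|].
move=> u u01; have [_ ->] := increment_gf i sh0 sth u01.
have [_ ->] := increment_gf i s0 st u01.
by rewrite opprD addrACA subrr addr0.
Qed.

(** The state at t is the increment over [0, t], independent of the one over [t, t + h], so the
    conditioning cancels. *)
Lemma split_transition i (t h : R) n j : 0 <= t -> 0 <= h ->
  (0 < P (N i t @^-1` [set n]))%E ->
  transition_prob P (N i) t n j h =
  Ex P (\1_(increment (N i) t (t + h) @^-1` [set j])).
Proof.
move=> t0 h0 Pn.
have th : t <= t + h by rewrite lerDl.
(* For t = 0 or h = 0 an interval degenerates, which the weak inequalities permit. *)
pose tt (l : nat) := if l is l'.+1 then (if l' is 0%N then t else t + h) else 0.
have Htt l : (l < 2)%N -> tt l <= tt l.+1 by case: l => [|[|l]].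
have indep := @split_increments_independent i 2 tt (lexx 0) Htt.
pose A (l : 'I_2) := if l == ord0 then N i t @^-1` [set n]
  else increment (N i) t (t + h) @^-1` [set j].
have := independent_family_seq (s := enum 'I_2) (A := A) indep (enum_uniq _).
have mN : measurable_fun setT (N i t) by have [mN _ _] := split_counting_process i; exact: mN.
have mA : measurable (N i t @^-1` [set n]) by exact: measurable_nat_preimage.
have mB : measurable (increment (N i) t (t + h) @^-1` [set j]).
  by apply: measurable_nat_preimage; exact: measurable_split_increment.
rewrite big_enum /= !big_ord_recl big_ord0 mule1 /A /=.
rewrite (_ : \bigcap_(l in _) _ = N i t @^-1` [set n] `&`
    increment (N i) t (t + h) @^-1` [set j]); last first.
  apply/seteqP; split=> w.
    move=> H; split.
      by have := H ord0; rewrite /= mem_enum; exact.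
    by have := H (lift ord0 ord0); rewrite /= mem_enum; exact.
  by move=> [H1 H2] l _; case: ifP.
move=> H; rewrite /transition_prob /cond_prob.
have -> : N i (t + h) @^-1` [set (n + j)%N] `&` N i t @^-1` [set n] =
    N i t @^-1` [set n] `&` increment (N i) t (t + h) @^-1` [set j].
  apply/seteqP; split=> w /=; rewrite /increment.
    by move=> [-> ->]; rewrite addKn.
  move=> [E <-]; split=> //; rewrite -E subnKC//.
  exact: split_mono.
rewrite H; last first.
  move=> l _; case: ifP => [/eqP->|l0].
    by exists [set n] => //; rewrite setTI /= split_increment0.
  exists [set j] => //; rewrite setTI.
  by case: l l0 => [[|[|l]] //= Hl].
rewrite fineM ?fin_num_measure// mulrC mulKf ?Ex_indic//.
by rewrite gt_eqF// fine_gt0// Pn /= -ge0_fin_numE// fin_num_measure.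
Qed.

Let mu_gt0 i j : 0 < mu i j.
Proof. by case: hM => lam0 _ _ _ _; rewrite mulr_gt0. Qed.

Lemma split_gcp i : gcp P (mu i) (N i).
Proof.
split.
- exact: mu_gt0.
- exact: split_counting_process.
- exact: split0.
- split; last exact: split_stationary.
  by move=> n t t0 Ht; apply: split_increments_independent => // l /Ht /ltW.
move=> t n t0 Pn.
have th (h : R) : 0 <= h -> t <= t + h by rewrite lerDl.
have mY h : 0 <= h -> measurable_fun setT (increment (N i) t (t + h)).
  by move=> /th; exact: measurable_split_increment.
have HG h s : 0 <= h -> 0 <= s <= 1 ->
    Ex P (fun w => s ^+ increment (N i) t (t + h) w) = expR (- (h * cumulant (mu i) s)).
  move=> h0 s01; have [_ ->] := increment_gf i t0 (th h h0) s01.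
  by rewrite [t + h]addrC addrK.
have [H0 HS] := exp_gf_rates mY (fun j => ltW (mu_gt0 i j)) HG.
have Htr j : \forall h \near 0^'+, transition_prob P (N i) t n j h =
    Ex P (\1_(increment (N i) t (t + h) @^-1` [set j])).
  have : \forall h \near (0 : R)^'+, 0 <= h by exact: nbhs_right_ge.
  by apply: filterS => h h0; exact: split_transition.
split=> [|j|j kj].
- apply/littleo_id_cvg.
  have H1 : (\sum_j mu i j -
      (1 - Ex P (\1_(increment (N i) t (t + h) @^-1` [set 0%N]))) / h) @[h --> 0^'+] --> (0 : R).
    by rewrite -[X in _ --> X](subrr (\sum_j mu i j)); apply: cvgB => //; exact: cvg_cst.
  apply: cvg_trans H1; apply: near_eq_cvg; near=> h.
  have h0 : 0 < h by near: h; exact: nbhs_right_gt.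
  have -> : transition_prob P (N i) t n 0 h =
    Ex P (\1_(increment (N i) t (t + h) @^-1` [set 0%N])) by near: h; exact: Htr.
  rewrite (_ : \sum_j mu i j * h = (\sum_j mu i j) * h); last by rewrite big_distrl.
  move: (\sum_j mu i j) (Ex P _) => a b.
  by field; exact: lt0r_neq0.
- apply/littleo_id_cvg.
  have H1 : (Ex P (\1_(increment (N i) t (t + h) @^-1` [set j.+1])) / h - mu i j)
      @[h --> 0^'+] --> (0 : R).
    rewrite -[X in _ --> X](subrr (mu i j)); apply: cvgB; last exact: cvg_cst.
    by have := HS j; rewrite jump_rateS.
  apply: cvg_trans H1; apply: near_eq_cvg; near=> h.
  have h0 : 0 < h by near: h; exact: nbhs_right_gt.
  have -> : transition_prob P (N i) t n j.+1 h =
    Ex P (\1_(increment (N i) t (t + h) @^-1` [set j.+1])) by near: h; exact: Htr.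
  by move: (mu i j) (Ex P _) => a b; field; exact: lt0r_neq0.
- apply/littleo_id_cvg; case: j kj => // j kj.
  have := HS j; rewrite (jump_rate_large (mu i) kj); apply: cvg_trans.
  apply: near_eq_cvg; near=> h; congr (_ / h); apply/esym.
  by near: h; exact: Htr.
Unshelve. all: by end_near. Qed.

(* Up to the grid point [t m], the increments ending before [tau] sum up to the
   value of the path at the smaller of [t m] and [tau]. *)
Lemma split_sum_increments i w (t : nat -> R) L m0 : t 0%N = 0 ->
  (forall l, (l < L)%N -> t l <= t l.+1) -> (m0 <= L)%N ->
  N i (t m0) w = (\sum_(l < L) (t l.+1 <= t m0)%R * increment (N i) (t l) (t l.+1) w)%N.
Proof.
move=> t0 Ht m0L.
have tm0 : 0 <= t m0 by rewrite -t0; exact: (chain_le Ht).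
suff main m : (m <= L)%N ->
    (\sum_(l < m) (t l.+1 <= t m0)%R * increment (N i) (t l) (t l.+1) w)%N =
    N i (Num.min (t m) (t m0))%R w.
  by rewrite main// (min_idPr _)//; exact: (chain_le Ht).
elim: m => [_|m IH mL]; first by rewrite big_ord0 t0 (min_idPl _)// split0.
rewrite big_ord_recr /= (IH (ltnW mL)).
have tm := Ht _ mL.
case: leP => h.
  rewrite mul1n (min_idPl (le_trans tm h)) /increment subnKC//.
  exact: split_mono.
rewrite mul0n addn0 (min_idPr _)//.
have [m0m|mm0] := leqP m0 m; first by apply: (chain_le Ht) => //; exact: ltnW.
by move: h; rewrite ltNge (chain_le Ht).
Qed.

(** The test functions involve different times for different faces. Merging these times into one
    sorted grid starting at 0 turns them into products of powers of increments, to which [split_gf]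
    applies. *)
Lemma split_processes_independent :
  independent_family P (fun i : 'I_q => sigma_of_process [set t : R | 0 <= t] (N i)).
Proof.
have mN i (t : R) : [set t | 0 <= t] t -> measurable_fun setT (N i t).
  by move=> t0; have [mN _ _] := split_counting_process i; exact: mN.
apply: (determines_independent
  (K := fun i => power_products [set t : R | 0 <= t] (N i))).
- by move=> i f; apply: power_products_bounded; exact: mN.
- by move=> i; apply: power_products_determine; exact: mN.
- by move=> i; exact: power_products1.
move=> r f ur Kf.
have {Kf}/choice[ls Hls] : forall i, exists l : seq (R * R),
  (forall u, u \in l -> 0 <= u.1 /\ 0 <= u.2 <= 1) /\
  f i = fun w => \prod_(u <- l) u.2 ^+ N i u.1 w by move=> i; exact: Kf.
pose ts : seq R := sort <=%R (0 :: flatten [seq map fst (ls i) | i <- enum 'I_q]).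
have mem_ts i u : u \in ls i -> u.1 \in ts.
  move=> ui; rewrite mem_sort inE; apply/orP; right; apply/flattenP.
  exists (map fst (ls i)); last exact: map_f.
  by apply: map_f; rewrite mem_enum.
have ts_ge0 u : u \in ts -> 0 <= u.
  rewrite mem_sort inE => /orP[/eqP->//|/flattenP[_ /mapP[i _ ->] /mapP[v vi ->]]].
  by have [Hi _] := Hls i; have [] := Hi v vi.
pose t l := nth 0 ts l; pose L := (size ts).-1.
have szts : size ts = L.+1 by rewrite /L /ts size_sort.
have Ht l : (l < L)%N -> t l <= t l.+1.
  move=> lL; apply: (le_sorted_leq_nth 0 (sort_le_sorted _)) => //.
    by rewrite inE szts ltnS ltnW.
  by rewrite inE szts ltnS.
have t0 : t 0%N = 0.
  have h0 : 0 \in ts by rewrite mem_sort mem_head.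
  apply/eqP; rewrite eq_le; apply/andP; split; last by apply/ts_ge0/mem_nth; rewrite szts.
  rewrite -[leRHS](nth_index 0 h0); apply: (chain_le Ht) => //.
  by rewrite -ltnS -szts index_mem.
(* The increment over [t l, t l.+1] is part of the value at every listed time u.1 >= t l.+1, so it
   collects all the corresponding bases. *)
pose s l i := \prod_(u <- ls i) (if t l.+1 <= u.1 then u.2 else 1).
have s01 l i : 0 <= s l i <= 1.
  have [Hi _] := Hls i; rewrite /s.
  elim: (ls i) Hi => [|u us IH] Hi; first by rewrite big_nil ler01 lexx.
  have /andP[h0 h1] : 0 <= \prod_(u <- us) (if t l.+1 <= u.1 then u.2 else 1) <= 1.
    by apply: IH => v vu; apply: Hi; rewrite inE vu orbT.
  have [_ /andP[u0 u1]] := Hi u (mem_head _ _).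
  rewrite big_cons; case: ifP => _; last by rewrite mul1r h0.
  by rewrite mulr_ge0//= mulr_ile1.
have fE i w : f i w = \prod_(l < L) s l i ^+ increment (N i) (t l) (t l.+1) w.
  have [_ ->] := Hls i; rewrite /s.
  under [RHS]eq_bigr do rewrite -prodrXl.
  rewrite exchange_big /= big_seq [RHS]big_seq; apply: eq_bigr => u ui.
  have uts := mem_ts i u ui.
  have iL : (index u.1 ts <= L)%N by rewrite -ltnS -szts index_mem.
  have := split_sum_increments i w t0 Ht iL; rewrite /t nth_index// => ->.
  rewrite -prodrXr; apply: eq_bigr => l _.
  by case: ifP => _; rewrite ?mul1n// mul0n expr0 expr1n.
pose e i := \prod_(l < L) expR (- ((t l.+1 - t l) * cumulant (mu i) (s l i))).
(* Applied to r and to each singleton, one formula gives both sides of the factorisation. *)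
suff main (r' : seq 'I_q) : uniq r' ->
    Ex P (fun w => \prod_(i <- r') f i w) = \prod_(i <- r') e i.
  rewrite main//; apply: eq_bigr => i _; have := main [:: i] isT.
  by rewrite big_seq1 => <-; apply: eq_Ex => w; rewrite big_seq1.
move=> ur'.
pose s' l i := if i \in r' then s l i else 1.
have s'01 l i : 0 <= s' l i <= 1.
  by rewrite /s'; case: ifP => // _; rewrite ler01 lexx.
have t0' : 0 <= t 0%N by rewrite t0.
have [_] := split_gf hM hq hp hp1 hxi t0' Ht s'01.
rewrite exchange_big (prod_uniq_if _ ur') (_ : \prod_(i < q) \prod_(l < L) expR _ =
    \prod_i (if i \in r' then e i else 1)).
  move=> <-; apply: eq_Ex => w; rewrite (prod_uniq_if _ ur') exchange_big.
  apply: eq_bigr => i _; rewrite /s'; case: ifP => _; first by rewrite fE.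
  by rewrite big1// => l _; rewrite expr1n.
apply: eq_bigr => i _; rewrite /s'; case: ifP => // _.
by rewrite big1// => l _; rewrite cumulant1 mulr0 oppr0 expR0.
Qed.

End split_components.

Unset Implicit Arguments.

Theorem mainTheorem4 (d : measure_display) (T : measurableType d)
    (R : realType) (P : probability T R)
    (k : nat) (hk : (1 <= k)%N) (lam : 'I_k -> R)
    (M : R -> T -> nat) (hM : gcp P lam M)
    (q : nat) (hq : (2 <= q)%N) (p : 'I_q -> R)
    (hp : forall i, 0 < p i) (hp1 : \sum_(i < q) p i = 1)
    (xi : nat -> T -> 'I_q) (hxi : die_rolls P p M xi) :
  independent_family P (fun i : 'I_q =>
      sigma_of_process [set t : R | 0 <= t] (typeI_split M xi i)) /\
  (forall i : 'I_q, gcp P (fun j => lam j * p i) (typeI_split M xi i)).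
Proof.
split; first exact: (split_processes_independent hM hq hp hp1 hxi).
move=> i; exact: (split_gcp hM hq hp hp1 hxi i).
Qed.
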